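(* There are absolute constants $c,C\in\mathbb{N}$ such that the following holds. Let $\mu$ be a measure on a set $D$ and let $H\subset L_2(\mu)$ be a reproducing kernel Hilbert space with kernel $$K(x,y)=\sum_{k=1}^\infty\sigma_k^2\,b_k(x)\,\overline{b_k(y)},\qquad x,y\in D,$$ where $(\sigma_k)\in\ell_2$ is a non-increasing sequence (of non-negative numbers) and $\{b_k\}_{k=1}^\infty$ is an orthonormal system in $L_2(\mu)$ such that there is a constant $B>0$ with $$\Big\|\frac1n\sum_{k=1}^n|b_k|^2\Big\|_\infty\le B\qquad\text{for all }n\in\mathbb{N}.$$ Then $H\subset L_\infty$ and, for all $n\in\mathbb{N}$, $$g_{cn}^{\mathrm{lin}}(H,L_\infty)^2\;\le\;B\cdot C\cdot\sum_{k>n}\sigma_k^2.$$ In particular, if $\mu$ is a finite measure, then, for all $n\in\mathbb{N}$, $$g_{cn}^{\mathrm{lin}}(H,L_\infty)\;\le\;\sqrt{B\cdot C\cdot\mu(D)}\cdot c_n(H,L_\infty).$$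
   Context: All functions are complex-valued. $L_\infty$ is the space of bounded functions on $D$ with $\|f\|_\infty=\sup_{x\in D}|f(x)|$ (a supremum, not an essential supremum). For a class $F$ of functions on $D$ contained in a seminormed space $G$, $$g_n^{\mathrm{lin}}(F,G):=\inf_{x_1,\dots,x_n\in D,\ \varphi_1,\dots,\varphi_n\in G}\ \sup_{f\in F}\Big\|f-\sum_{i=1}^nf(x_i)\varphi_i\Big\|_G$$ is the $n$-th linear sampling number, and $$c_n(F,G):=\inf_{\psi\colon\mathbb{C}^n\to G,\ N\colon F\to\mathbb{C}^n\text{ linear}}\ \sup_{f\in F}\|f-\psi\circ N(f)\|_G$$ is the Gelfand $n$-width ($\psi$ arbitrary, possibly non-linear). If $F$ is a normed space (such as $H$), then $g_n^{\mathrm{lin}}(F,G)$ and $c_n(F,G)$ mean the quantities with the supremum taken over the unit ball of $F$ (i.e. with the class being the unit ball). The series for $K$ converges pointwise on $D\times D$. *)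

(* Defs.v *)
From HB Require Import structures.
From mathcomp Require Import all_boot all_order all_algebra.
From mathcomp Require Import complex.
From mathcomp Require Import all_classical all_reals all_analysis.

Set Implicit Arguments.
Unset Strict Implicit.
Unset Printing Implicit Defensive.

Import Order.TTheory GRing.Theory Num.Theory.
Import numFieldNormedType.Exports ComplexField.Normc.

Local Open Scope classical_set_scope.
Local Open Scope complex_scope.
Local Open Scope ring_scope.

(* A reproducing kernel Hilbert space of complex-valued functions on D: a
   Hilbert space H (inner product linear in the first argument) whose elements
   are identified with functions on D through the injection rkhs_eval, and which
   possesses a reproducing kernel K:
   K(., y) belongs to H and f(y) = <f, K(., y)>. *)
Record rkhs (R : realType) (D : Type) (K : D -> D -> R[i]) := Rkhs {
  rkhs_space :> completeNormedModType R[i] ;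
  rkhs_dot : {dot rkhs_space for (@Num.conj R[i])} ;
  rkhs_normE : forall f : rkhs_space, `|f| ^+ 2 = rkhs_dot f f ;
  rkhs_eval : rkhs_space -> D -> R[i] ;
  rkhs_eval_linear : forall x : D, scalar (fun f => rkhs_eval f x) ;
  rkhs_eval_inj : injective rkhs_eval ;
  rkhs_reproducing : forall y : D, exists k : rkhs_space,
    rkhs_eval k = (fun x => K x y) /\
    (forall f, rkhs_eval f y = rkhs_dot f k) }.

Definition rkhs_functions (R : realType) (D : Type) (K : D -> D -> R[i])
  (H : rkhs K) : set (D -> R[i]) := range (@rkhs_eval _ _ _ H).

Definition unit_ball (R : realType) (V : normedModType R[i]) : set V :=
  [set f | `|f| <= 1].

(* D is nonempty, so that the supremum is never -oo; it is +oo exactly for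
   unbounded functions. *)
Definition supnorm (R : realType) (D : pointedType) (f : D -> R[i]) : \bar R :=
  ereal_sup [set (normc (f x))%:E | x in [set: D]].

Definition Linfty (R : realType) (D : pointedType) : set (D -> R[i]) :=
  [set f : D -> R[i] | (supnorm f < +oo)%E].

Definition L2 (R : realType) d (D : measurableType d)
    (mu : {measure set D -> \bar R}) : set (D -> R[i]) :=
  [set f : D -> R[i] | [/\ measurable_fun [set: D] (fun x => complex.Re (f x)),
               measurable_fun [set: D] (fun x => complex.Im (f x)) &
               (\int[mu]_x ((normc (f x)) ^+ 2)%:E < +oo)%E]].

Definition complex_integral (R : realType) d (D : measurableType d)
    (mu : {measure set D -> \bar R}) (f : D -> R[i]) : R[i] :=
  Rintegral mu [set: D] (fun x => complex.Re (f x)) +i*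
  Rintegral mu [set: D] (fun x => complex.Im (f x)).

Definition orthonormal_system (R : realType) d (D : measurableType d)
    (mu : {measure set D -> \bar R}) (b : nat -> D -> R[i]) : Prop :=
  (forall k, L2 mu (b k)) /\
  (forall j k, complex_integral mu (fun x => b j x * (b k x)^*) = (j == k)%:R).

(* Linear sampling numbers of a class F in a seminormed space G of functions,
   whose seminorm is given as an extended-real-valued function. *)
Definition lin_sampling_number (R : realType) (D : Type) (n : nat)
    (F G : set (D -> R[i])) (normG : (D -> R[i]) -> \bar R) : \bar R :=
  ereal_inf [set ereal_sup
      [set normG (fun y => f y - \sum_(i < n) f (xphi.1 i) * xphi.2 i y)
         | f in F]
    | xphi in [set xphi : ('I_n -> D) * ('I_n -> D -> R[i]) |
                 forall i, G (xphi.2 i)]].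

(* Gelfand widths of a class A contained in a vector space V whose elements act
   as functions on D through ev; the information map N is an arbitrary linear
   map on V, continuity is not required. *)
Definition gelfand_width (R : realType) (D : Type) (n : nat)
    (V : lmodType R[i]) (ev : V -> D -> R[i]) (A : set V)
    (G : set (D -> R[i])) (normG : (D -> R[i]) -> \bar R) : \bar R :=
  ereal_inf [set ereal_sup
      [set normG (fun y => ev f y - psiN.1 (psiN.2 f) y) | f in A]
    | psiN in [set psiN : ('rV[R[i]]_n -> D -> R[i]) *
                          {linear V -> 'rV[R[i]]_n} |
                 forall v, G (psiN.1 v)]].

Definition rkhs_lin_sampling_number (R : realType) (D : Type)
    (K : D -> D -> R[i]) (n : nat) (H : rkhs K) (G : set (D -> R[i]))
    (normG : (D -> R[i]) -> \bar R) : \bar R :=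
  lin_sampling_number n (@rkhs_eval _ _ _ H @` @unit_ball R H) G normG.

Definition rkhs_gelfand_width (R : realType) (D : Type)
    (K : D -> D -> R[i]) (n : nat) (H : rkhs K) (G : set (D -> R[i]))
    (normG : (D -> R[i]) -> \bar R) : \bar R :=
  gelfand_width n (@rkhs_eval _ _ _ H) (@unit_ball R H) G normG.

(* Main.v *)
Require Import Defs.
From mathcomp Require Import all_boot all_order all_fingroup all_algebra.
From mathcomp Require Import complex.
From mathcomp Require Import all_classical all_reals all_analysis.
From mathcomp Require Import measurable_realfun.
From mathcomp Require Import ring lra zify.
Set Implicit Arguments.
Unset Strict Implicit.
Unset Printing Implicit Defensive.
Import Order.TTheory GRing.Theory Num.Theory.
Import numFieldNormedType.Exports ComplexField.Normc.
Local Open Scope classical_set_scope.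
Local Open Scope complex_scope.
Local Open Scope ring_scope.

(* With e_k = sigma_k b_k and k_x = K(., x), interpolation at points x_i
   recovers f(x) up to |f| times the distance of k_x to the span of the k_(x_i),
   and the square of this distance is a ratio of Gram determinants.
   Let t bound sum_(k >= n) |e_k|^2, and let a_p be the supremum of the Gram
   determinants of p kernel functions.  Splitting each k_x into its first n
   coordinates and a remainder of squared norm at most t, and expanding the
   volume by multilinearity, gives a_(2n) <= 16^n t^n a_n as soon as
   a_p t^(n-p) <= a_n for p <= n; hence a_(p+1) <= 16 t a_p for some p < 2n, and
   near-maximal p points have squared distances at most 32 t everywhere.
   Summation by parts bounds t, taken from the index 2n on, by 2 B times the
   tail of sigma^2 from the index n on.
   For the Gelfand width, an information map of rank n annihilates an
   orthonormal family of at least N - n coefficient vectors in C^N, so that the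
   squared values of the corresponding functions add up to at most the squared
   width; integrating and rearranging leaves the tail of sigma^2. *)

(** * Gram determinants as squared volumes: adding, splitting and permuting vectors *)

Section GramDeterminant.
Variables (C : numClosedFieldType) (U : lmodType C).
Variable dot : {dot U for (@Num.conj C)}.
Local Notation "''[' u , v ]" := (dot u v) : ring_scope.
Local Notation "''[' u ]" := (dot u u) : ring_scope.
Implicit Types (s : seq U) (r : U).

Definition gram s : 'M[C]_(size s) := \matrix_(i, j) '[s`_i, s`_j].
Definition gdet s : C := \det (gram s).
Definition lincomb s (z : 'rV[C]_(size s)) : U := \sum_i z 0 i *: s`_i.
Arguments lincomb s z : clear implicits.
(** Coefficients of the orthogonal projection of [r] onto the span of [s], meaningful when the Gram
    matrix is invertible. *)
Definition gram_coef s r : 'rV[C]_(size s) := (\row_i '[r, s`_i]) *m invmx (gram s).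

Lemma dotC u v : '[u, v] = ('[v, u])^*.
Proof. by rewrite [LHS]hermC expr0 mul1r. Qed.

Lemma dotBl u v w : '[u - v, w] = '[u, w] - '[v, w].
Proof. exact: linearBl. Qed.

Lemma dotBr u v w : '[u, v - w] = '[u, v] - '[u, w].
Proof. exact: linearBr. Qed.

Lemma dot0l u : '[0, u] = 0.
Proof. exact: linear0l. Qed.

Lemma dot_ge0 u : 0 <= '[u].
Proof. exact: dnorm_ge0. Qed.

Lemma dotDd u v : '[u, v] = 0 -> '[u + v] = '[u] + '[v].
Proof. exact: hnormDd. Qed.

Lemma gdet_nil : gdet [::] = 1.
Proof. by rewrite /gdet det_mx00. Qed.

Lemma dot_lincombl s z v : '[lincomb s z, v] = \sum_i z 0 i * '[s`_i, v].
Proof.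
rewrite /lincomb [LHS](linear_sumlz dot); apply: eq_bigr => i _.
exact: linearZl_LR.
Qed.

Lemma gram_coef_ortho s r i : gdet s != 0 -> (i < size s)%N ->
  '[r - lincomb s (gram_coef s r), s`_i] = 0.
Proof.
move=> s0 ltis; rewrite dotBl dot_lincombl.
have uG : gram s \in unitmx by rewrite unitmxE unitfE.
have /rowP/(_ (Ordinal ltis)) := mulmxKV uG (\row_i '[r, s`_i]).
rewrite [RHS]mxE /= => <-; rewrite -/(gram_coef s r) [X in X - _]mxE -sumrB.
by rewrite big1// => j _; rewrite [X in _ * X - _]mxE subrr.
Qed.

Lemma gram_coef_ortho_lincomb s r z : gdet s != 0 ->
  '[r - lincomb s (gram_coef s r), lincomb s z] = 0.
Proof.
move=> s0; rewrite dotC dot_lincombl big1 ?conjC0// => i _.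
by rewrite dotC gram_coef_ortho ?conjC0 ?mulr0.
Qed.

Lemma lincombB s z z' : lincomb s (z - z') = lincomb s z - lincomb s z'.
Proof.
by rewrite /lincomb -sumrB; apply: eq_bigr => i _; rewrite !mxE scalerBl.
Qed.

Lemma lincombD s z z' : lincomb s (z + z') = lincomb s z + lincomb s z'.
Proof.
by rewrite /lincomb -big_split; apply: eq_bigr => i _; rewrite !mxE scalerDl.
Qed.

Lemma gram_cons r s : gram (r :: s) =
  block_mx '[r]%:M (\row_i '[r, s`_i]) (\col_i '[s`_i, r]) (gram s) :> 'M[C]_(1 + size s).
Proof.
apply/matrixP => i j; rewrite !mxE.
case: (@splitP 1 (size s) i) => i' ->; rewrite ?ord1 !mxE;
case: (@splitP 1 (size s) j) => j' ->; rewrite ?ord1 !mxE //=.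
Qed.

(** Base times squared height: a unipotent row operation subtracts the projection from [r] and
    leaves a block triangular matrix. *)
Lemma gdet_cons_coef r s : gdet s != 0 ->
  gdet (r :: s) = gdet s * '[r - lincomb s (gram_coef s r)].
Proof.
move=> s0; have uG : gram s \in unitmx by rewrite unitmxE unitfE.
pose z := gram_coef s r.
have -> : gdet (r :: s) = \det (block_mx 1%:M (- z) 0 1%:M *m
    block_mx '[r]%:M (\row_i '[r, s`_i]) (\col_i '[s`_i, r]) (gram s)).
  by rewrite det_mulmx det_ublock !det1 !mul1r /gdet gram_cons.
rewrite mulmx_block !mul1mx !mul0mx !add0r !mulNmx mulmxKV// subrr.
rewrite det_lblock det_mx11 mulrC; congr (_ * _).
have : '[r - lincomb s z] = '[r - lincomb s z, r].
  by rewrite (dotBr (r - lincomb s z)) gram_coef_ortho_lincomb ?subr0.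
move=> ->; rewrite !mxE eqxx mulr1n dotBl dot_lincombl.
by congr (_ - _); apply: eq_bigr => i _; rewrite !mxE.
Qed.

(** A left null vector of the Gram matrix gives a linear combination of norm zero; padded by 0, it
    is a null vector of the larger matrix. *)
Lemma gdet_cons_eq0 r s : gdet s = 0 -> gdet (r :: s) = 0.
Proof.
move=> /eqP /det0P [t t0 tG].
have lt0 : lincomb s t = 0.
  apply/eqP; rewrite -(dnorm_eq0 dot) dot_lincombl; apply/eqP.
  rewrite (eq_bigr (fun i => \sum_j (t 0 j)^* * (t 0 i * '[s`_i, s`_j]))); last first.
    move=> i _; rewrite dotC dot_lincombl rmorph_sum mulr_sumr; apply: eq_bigr => j _.
    by rewrite rmorphM /= -dotC mulrCA.
  rewrite exchange_big /= big1// => j _; rewrite -mulr_sumr.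
  move: tG => /rowP /(_ j); rewrite !mxE => tG.
  rewrite (_ : \sum_i _ = 0) ?mulr0// -[RHS]tG.
  by apply: eq_bigr => i _; rewrite mxE.
apply/eqP/det0P; exists (row_mx 0 t : 'rV_(1 + size s)).
  apply: contra_neq t0 => /(congr1 (@rsubmx _ 1 1 (size s))).
  by rewrite row_mxKr linear0.
rewrite gram_cons [LHS](@mul_row_block _ 1 1 (size s) 1 (size s)) !mul0mx !add0r tG.
rewrite (_ : t *m _ = 0) ?row_mx0//; apply/rowP => i; rewrite ord1 !mxE.
by under eq_bigr do rewrite mxE; rewrite -dot_lincombl lt0 dot0l.
Qed.

Lemma dist_lincomb r s z : gdet s != 0 ->
  '[r - lincomb s (gram_coef s r)] <= '[r - lincomb s z].
Proof.
move=> s0; pose z0 := gram_coef s r.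
have -> : r - lincomb s z = (r - lincomb s z0) + lincomb s (z0 - z).
  by rewrite lincombB addrA subrK.
by rewrite (dotDd (gram_coef_ortho_lincomb _ _ s0)) lerDl dot_ge0.
Qed.

Lemma gdet_ge0 s : 0 <= gdet s.
Proof.
elim: s => [|r s IH]; first by rewrite gdet_nil ler01.
have [s0|s0] := eqVneq (gdet s) 0; first by rewrite gdet_cons_eq0.
by rewrite gdet_cons_coef// mulr_ge0 ?dot_ge0.
Qed.

Lemma gdet_cons_le r s z : gdet (r :: s) <= gdet s * '[r - lincomb s z].
Proof.
have [s0|s0] := eqVneq (gdet s) 0; first by rewrite gdet_cons_eq0// s0 mul0r.
by rewrite gdet_cons_coef// ler_wpM2l ?gdet_ge0 ?dist_lincomb.
Qed.

Lemma gdet_cons_norm r s : gdet (r :: s) <= '[r] * gdet s.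
Proof.
rewrite mulrC -[X in '[X]]subr0; have <- : lincomb s 0 = 0.
  by rewrite /lincomb big1// => i _; rewrite mxE scale0r.
exact: gdet_cons_le.
Qed.

Lemma dnormD_le u v : '[u + v] <= 2 * '[u] + 2 * '[v].
Proof.
rewrite -subr_ge0; apply: le_trans (dnorm_ge0 dot (u - v)) _.
rewrite le_eqVlt; apply/orP; left; apply/eqP.
by rewrite dnormB dnormD; ring.
Qed.

(** Subtracting the projection onto the span of [s] is linear, and [|a + b|^2 <= 2 |a|^2 + 2 |b|^2].
    This replaces multilinear expansion and has no cross terms. *)
Lemma gdet_consD u v s : gdet (u + v :: s) <= 2 * gdet (u :: s) + 2 * gdet (v :: s).
Proof.
have [s0|s0] := eqVneq (gdet s) 0; first by rewrite !gdet_cons_eq0// !mulr0 addr0.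
pose zu := gram_coef s u; pose zv := gram_coef s v.
apply: le_trans (gdet_cons_le _ (zu + zv)) _.
rewrite !gdet_cons_coef// !(mulrCA 2) -mulrDr ler_wpM2l ?gdet_ge0//.
by rewrite lincombD opprD addrACA dnormD_le.
Qed.

Lemma gdet_gram n s (x : 'I_n -> U) : size s = n -> (forall i : 'I_n, s`_i = x i) ->
  gdet s = \det (\matrix_(i, j) '[x i, x j]).
Proof.
move=> sn; case: _ / sn x => x sx; congr (\det _).
by apply/matrixP => i j; rewrite !mxE !sx.
Qed.

Lemma gdet_perm s t : perm_eq s t -> gdet s = gdet t.
Proof.
move=> st; have szst := perm_size st.
have /tuple_permP [p sE] : perm_eq s (in_tuple t) by [].
rewrite (@gdet_gram (size t) s (fun i => t`_(p i)))//; last first.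
  move=> i; rewrite sE (nth_map i) ?size_enum_ord//.
  by rewrite (tnth_nth 0) nth_ord_enum.
transitivity (\det (row_perm p (col_perm p (gram t)))).
  by congr (\det _); apply/matrixP => i j; rewrite !mxE.
rewrite row_permE col_permE !det_mulmx !det_perm odd_permV mulrC.
by rewrite -mulrA -signr_addb addbb mulr1.
Qed.

(** With the same coefficients, the optimal error for [v i + w i] splits into orthogonal [v] and [w]
    parts, so [v i] is approximated at least as well, and each height can only grow when the [w i]
    are added. *)
Lemma gdet_map_le (I : Type) (v w : I -> U) (s : seq I) :
  (forall i j, '[v i, w j] = 0) ->
  gdet (map v s) <= gdet (map (fun i => v i + w i) s).
Proof.
move=> vw; pose u i := v i + w i; rewrite -/u.
elim: s => [|i s IH] /=; first by rewrite !gdet_nil.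
have [s0|s0] := eqVneq (gdet (map u s)) 0.
  have v0 : gdet (map v s) = 0 by apply/eqP; rewrite eq_le gdet_ge0 -s0 IH.
  by rewrite gdet_cons_eq0 ?gdet_ge0.
pose z := gram_coef (map u s) (u i).
have szE : size (map u s) = size (map v s) by rewrite !size_map.
apply: le_trans (gdet_cons_le _ (castmx (erefl, szE) z)) _.
rewrite gdet_cons_coef// -/z; apply: ler_pM; rewrite ?gdet_ge0 ?dot_ge0//.
pose wz := w i - \sum_(j < size (map u s)) z 0 j *: (map w s)`_j.
have -> : u i - lincomb (map u s) z =
    (v i - lincomb (map v s) (castmx (erefl, szE) z)) + wz.
  rewrite /wz addrACA -opprD; congr (_ - _).
  have -> : lincomb (map v s) (castmx (erefl, szE) z) =
      \sum_(j < size (map u s)) z 0 j *: (map v s)`_j.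
    rewrite /lincomb (reindex (cast_ord szE)); last first.
      by exists (cast_ord (esym szE)) => k _; rewrite ?cast_ordK ?cast_ordKV.
    apply: eq_bigr => j _; rewrite castmxE /=; congr (z _ _ *: _).
      by rewrite cast_ord_id.
    by rewrite cast_ordK.
  rewrite -big_split /=; apply: eq_bigr => j _; rewrite -scalerDr; congr (_ *: _).
  by case: j => j /=; rewrite size_map => ltj; rewrite !(nth_map i).
rewrite [leRHS]dotDd ?lerDl ?dot_ge0//.
suff vwz x : (forall j, '[x, w j] = 0) -> '[x, wz] = 0.
  apply: vwz => j; rewrite dotBl vw dot_lincombl big1 ?subrr// => k _.
  by case: k => k /= kP; rewrite (nth_map i) ?vw ?mulr0// -(size_map v).
move=> x0; rewrite dotBr x0 dotC.
have -> : \sum_(j < size (map u s)) z 0 j *: (map w s)`_j = 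
  \sum_(j < size (map u s)) z 0 j *: w (nth i s j).
  by apply: eq_bigr => j _; rewrite (nth_map i)// -(size_map u).
rewrite (linear_sumlz dot) big1 ?conjC0 ?subrr// => j _.
by rewrite [LHS]linearZl_LR -[X in _ * X]conjCK -dotC x0 conjC0 mulr0.
Qed.

(* Every [u i = v i + w i] of the second list is expanded in turn:
   replacing it by [w i] costs a factor [t], replacing it by [v i] moves it to
   the first list, whose length is limited by the dimension [n]. *)
Lemma gdet_mixed_le (I : Type) (v w : I -> U) (t M : C) (n m : nat)
    (p q : seq I) :
  0 <= t -> 0 <= M ->
  (forall i j, '[v i, w j] = 0) -> (forall i, '[w i] <= t) ->
  (forall s : seq I, (n < size s)%N -> gdet (map v s) = 0) ->
  (forall s : seq I, (size s <= n)%N ->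
     gdet (map (fun i => v i + w i) s) * t ^+ (m - size s) <= M) ->
  (size p + size q <= m)%N ->
  gdet (map v p ++ map (fun i => v i + w i) q) * t ^+ (m - (size p + size q))
    <= 4 ^+ size q * M.
Proof.
move=> t0 M0 vw wt vn uM; pose u i := v i + w i; rewrite -/u.
elim: q p => [|i q IH] p; rewrite /= ?addnS => pqm.
  rewrite cats0 addn0 expr0 mul1r; have [pn|np] := leqP (size p) n.
    apply: le_trans (uM _ pn); rewrite ler_wpM2r ?exprn_ge0//.
    exact: gdet_map_le.
  by rewrite vn// mul0r.
have pqm' := ltnW pqm.
have -> : gdet (map v p ++ u i :: map u q) = gdet (u i :: map v p ++ map u q).
  by apply: gdet_perm; rewrite -cat1s perm_catCA.
have := gdet_consD (v i) (w i) (map v p ++ map u q); rewrite -/(u i) => uvw.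
apply: (le_trans (ler_wpM2r _ uvw)); first by rewrite exprn_ge0.
have ww : gdet (w i :: map v p ++ map u q) <= t * gdet (map v p ++ map u q).
  by apply: le_trans (gdet_cons_norm _ _) _; rewrite ler_wpM2r ?gdet_ge0.
have := IH (i :: p); rewrite /= addSn => /(_ pqm) IHv.
have := IH p pqm'; rewrite (_ : (m - (size p + size q) = (m - (size p + size q).+1).+1)%N); last by rewrite subnSK.
rewrite exprS mulrA (mulrC _ t) => IHw.
rewrite mulrDl exprS -!mulrA.
have -> : 4 * (4 ^+ size q * M) = 2 * (4 ^+ size q * M) + 2 * (4 ^+ size q * M) by ring.
rewrite lerD// ler_wpM2l ?ler0n//.
by apply: le_trans IHw; rewrite ler_wpM2r ?exprn_ge0.
Qed.
End GramDeterminant.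
Arguments lincomb {C U} s z.

Lemma dot_CauchySchwarz (C : numClosedFieldType) (U : lmodType C)
    (dot : {dot U for (@Num.conj C)}) (u v : U) :
  `|dot u v| ^+ 2 <= dot u u * dot v v.
Proof.
have [->|v0] := eqVneq v 0; first by rewrite [dot u 0]dotC !dot0l conjC0 normr0 expr0n mulr0.
have vp : 0 < dot v v by rewrite (dnorm_gt0 dot).
pose a := dot u v / dot v v.
have ao : dot (u - a *: v) (a *: v) = 0.
  rewrite [LHS](linearZr_LR dot) /= dotBl [dot (a *: v) v](linearZl_LR dot) /=.
  by rewrite divfK ?subrr ?mulr0// gt_eqF.
rewrite -{2 3}[u](subrK (a *: v)) dotDd// [dot (a *: v) _](dnormZ dot) mulrDl.
rewrite normf_div exprMn exprVn (ger0_norm (ltW vp)) -mulrA -expr2 divfK.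
  by rewrite lerDr mulr_ge0 ?dot_ge0.
by rewrite expf_neq0 ?gt_eqF.
Qed.

Lemma gdet_map_eq (C : numClosedFieldType) (U U' : lmodType C)
    (dot : {dot U for (@Num.conj C)}) (dot' : {dot U' for (@Num.conj C)})
    (I : Type) (u : I -> U) (u' : I -> U') (s : seq I) :
  (forall i j, dot (u i) (u j) = dot' (u' i) (u' j)) ->
  gdet dot (map u s) = gdet dot' (map u' s).
Proof.
move=> uu'; case: s => [|i0 s]; first by rewrite !gdet_nil.
pose x := nth i0 (i0 :: s).
rewrite (@gdet_gram _ _ dot (size (i0 :: s)) _ (fun i => u (x i))); last 2 first.
- by rewrite size_map.
- by move=> i; rewrite (nth_map i0).
rewrite (@gdet_gram _ _ dot' (size (i0 :: s)) _ (fun i => u' (x i))); last 2 first.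
- by rewrite size_map.
- by move=> i; rewrite (nth_map i0).
by congr (\det _); apply/matrixP => i j; rewrite !mxE.
Qed.

(** * Positive semidefinite factorization and the volume bound with [n] free coordinates *)

Section Factorization.
Local Open Scope sesquilinear_scope.
Variable C : numClosedFieldType.

(** Spectral theorem: the eigenvalues are the values of the form at the rows of [P], hence
    nonnegative, and [Z] is built from their square roots. *)
Lemma psd_factor n (B : 'M[C]_n) : B ^t* = B ->
  (forall z : 'rV_n, 0 <= (z *m B *m z ^t*) 0 0) -> exists Z : 'M[C]_n, B = Z *m Z ^t*.
Proof.
move=> Bh Bp; set P := spectralmx B; set d := spectral_diag B.
have Pu : P \is unitarymx by exact: spectral_unitarymx.
have BE : B = P ^t* *m diag_mx d *m P.
  rewrite -invmx_unitary//; apply/orthomx_spectralP/normalmxP.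
  by rewrite Bh.
have d0 i : 0 <= d 0 i.
  have := Bp (row i P); rewrite -!row_mul BE.
  have PP : P *m P ^t* = 1%:M by apply/unitarymxP.
  rewrite !mulmxA PP mul1mx -mulmxA.
  have -> : P *m (row i P) ^t* = col i 1%:M.
    by rewrite -PP; apply/colP => j; rewrite !mxE; apply: eq_bigr => k _; rewrite !mxE.
  by rewrite colE mulmxA mulmx1 -colE !mxE eqxx mulr1n.
exists (P ^t* *m diag_mx (map_mx sqrtC d)).
rewrite trmx_mul map_mxM /= trmxCK {1}BE !mulmxA; congr (_ *m _).
rewrite -!mulmxA; congr (_ *m _).
rewrite tr_diag_mx map_diag_mx mulmx_diag; congr diag_mx.
apply/rowP => i; rewrite !mxE /= conj_Creal ?ger0_real ?sqrtC_ge0//.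
by rewrite -expr2 sqrtCK.
Qed.

(** The Gram matrix is [W *m W ^t*] where [W] has only [n] columns, so its rank is below its
    size. *)
Lemma gdet_rank (I : Type) n (v : I -> 'rV[C]_n) (U : lmodType C)
    (dot : {dot U for (@Num.conj C)}) (u : I -> U) (s : seq I) :
  (forall i j, dot (u i) (u j) = (v i *m (v j) ^t*) 0 0) ->
  (n < size s)%N -> gdet dot (map u s) = 0.
Proof.
case: s => // i0 s uv ns.
pose x := nth i0 (i0 :: s).
rewrite (@gdet_gram _ _ dot (size (i0 :: s)) _ (fun i => u (x i))); last 2 first.
- by rewrite size_map.
- by move=> i; rewrite (nth_map i0).
pose W : 'M[C]_(size (i0 :: s), n) := \matrix_(i, j) v (x i) 0 j.
have -> : \matrix_(i, j) dot (u (x i)) (u (x j)) = W *m W ^t*.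
  apply/matrixP => i j; rewrite !mxE uv !mxE.
  by apply: eq_bigr => k _; rewrite !mxE.
apply/eqP; rewrite -[_ == 0]negbK -unitfE -unitmxE -row_free_unit -row_leq_rank -ltnNge.
by apply: leq_ltn_trans ns; apply: leq_trans (mxrankM_maxl _ _) (rank_leq_col _).
Qed.

(** The hypotheses make [G - V V^*] positive semidefinite with diagonal at most [t]. Once it is
    factored as [Z Z^*], the vectors [(V_i, 0)] and [(0, Z_i)] of dimension [n + m] form a model
    with the Gram matrix of [k] in which coordinates and remainders are orthogonal. *)
Lemma gdet_codim_le (U : lmodType C) (dot : {dot U for (@Num.conj C)}) (m n : nat)
    (k : 'I_m -> U) (V : 'M[C]_(m, n)) (t M : C) :
  0 <= t -> 0 <= M ->
  (forall z : 'rV_m, ((z *m V) *m (z *m V) ^t*) 0 0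
     <= dot (\sum_i z 0 i *: k i) (\sum_i z 0 i *: k i)) ->
  (forall i, dot (k i) (k i) - (row i V *m (row i V) ^t*) 0 0 <= t) ->
  (forall s : seq 'I_m, (size s <= n)%N ->
     gdet dot (map k s) * t ^+ (m - size s) <= M) ->
  gdet dot (map k (enum 'I_m)) <= 4 ^+ m * M.
Proof.
move=> t0 M0 VB Vt kM.
pose G : 'M[C]_m := \matrix_(i, j) dot (k i) (k j).
have [|z|Z BE] := @psd_factor _ (G - V *m V ^t*).
- rewrite linearB /= map_mxB; congr (_ - _).
    by apply/matrixP => i j; rewrite !mxE /= -dotC.
  by rewrite trmx_mul map_mxM /= trmxCK.
- rewrite mulmxBr mulmxBl [X in 0 <= X]mxE [X in _ + X]mxE subr_ge0.
  have := VB z; rewrite trmx_mul map_mxM !mulmxA => /le_trans; apply.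
  rewrite le_eqVlt; apply/orP; left; apply/eqP.
  rewrite (linear_sumlz dot) !mxE.
  under [RHS]eq_bigr do rewrite mxE mulr_suml.
  rewrite exchange_big; apply: eq_bigr => i _.
  rewrite [LHS]linearZl_LR -/(dot _ _) [X in _ * X](linear_sumr dot) mulr_sumr.
  by apply: eq_bigr => j _; rewrite [X in _ * X](linearZr_LR dot) !mxE /= mulrA mulrAC.
pose v i : 'rV[C]_(n + m) := row_mx (row i V) 0.
pose w i : 'rV[C]_(n + m) := row_mx 0 (row i Z).
pose dm : {dot 'rV[C]_(n + m) for (@Num.conj C)} := @dotmx C (n + m).
have dmE x y : dm x y = (x *m y ^t*) 0 0 by exact: dotmxE.
have row_dot a b c (X : 'M[C]_(a, c)) (Y : 'M[C]_(b, c)) i j :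
    (row i X *m (row j Y) ^t*) 0 0 = (X *m Y ^t*) i j.
  by rewrite !mxE; apply: eq_bigr => l _; rewrite !mxE.
have vv i j : dm (v i) (v j) = (V *m V ^t*) i j.
  by rewrite dmE /v tr_row_mx map_col_mx mul_row_col mul0mx addr0 row_dot.
have ww i j : dm (w i) (w j) = (Z *m Z ^t*) i j.
  by rewrite dmE /w tr_row_mx map_col_mx mul_row_col mul0mx add0r row_dot.
have vw i j : dm (v i) (w j) = 0.
  by rewrite dmE /w tr_row_mx map_col_mx mul_row_col !linear0 map_mx0 mulmx0 mul0mx addr0 mxE.
have uk i j : dm (v i + w i) (v j + w j) = dot (k i) (k j).
  have -> : dm (v i + w i) (v j + w j) =
    dm (v i) (v j) + dm (v i) (w j) + (dm (w i) (v j) + dm (w i) (w j)).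
    by rewrite [LHS](linearDl dm) !(linearDr dm).
  rewrite vw [dm (w i) (v j)]dotC vw conjC0 addr0 add0r vv ww.
  have /matrixP/(_ i j) := BE.
  by rewrite [LHS]mxE [X in X + _]mxE [X in _ + X]mxE => <-; rewrite addrCA subrr addr0.
have := @gdet_mixed_le C _ dm _ v w t M n m [::] (enum 'I_m) t0 M0 vw.
rewrite /= add0n size_enum_ord subnn expr0 mulr1 (gdet_map_eq _ uk); apply => //.
- move=> i; apply: le_trans (Vt i); rewrite ww -BE row_dot !mxE.
  by rewrite !lexx.
- move=> s; apply: (@gdet_rank _ _ (fun i => row i V)) => i j.
  by rewrite vv row_dot.
- by move=> s sn; rewrite (gdet_map_eq _ uk) kM.
Qed.
End Factorization.

(** * Limits of inequalities between complex numbers *)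

Section ComplexLimits.
Variable R : realType.
Implicit Types (T : nat -> R[i]) (L x : R[i]).

(** The order on [R[i]] is partial; the realness hypotheses allow an inequality to be negated. *)
Lemma cvgC_ge T L x : x \is Num.real -> L \is Num.real ->
  (T : nat -> R[i]^o) @ \oo --> (L : R[i]^o) ->
  (\forall n \near \oo, x <= T n) -> x <= L.
Proof.
move=> xr Lr TL xT; rewrite real_leNgt//; apply/negP => Lx.
have [n [xTn]] : exists n, x <= T n /\ `|L - T n| < x - L.
  apply: (@filter_ex _ \oo); near=> n; split; first by near: n.
  near: n; move: (x - L) (subr_gt0 L x); rewrite Lx => eps eps0.
  by move: TL => /cvgrPdist_lt; apply.
apply/negP; rewrite -real_leNgt ?realB ?normr_real// distrC.
have TnL : L <= T n by apply: le_trans xTn; exact: ltW.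
by rewrite ger0_norm ?subr_ge0// lerD2r.
Unshelve. all: by end_near. Qed.

Lemma cvgC_le T L x : x \is Num.real -> L \is Num.real ->
  (T : nat -> R[i]^o) @ \oo --> (L : R[i]^o) ->
  (\forall n \near \oo, T n <= x) -> L <= x.
Proof.
move=> xr Lr TL xT; rewrite -lerN2.
have NT : ((fun n => - T n) : nat -> R[i]^o) @ \oo --> (- L : R[i]^o).
  by apply: cvgN.
have xNT : \forall n \near \oo, - x <= - T n by near=> n; rewrite lerN2; near: n.
by apply: (cvgC_ge _ _ NT xNT); rewrite realN.
Unshelve. all: by end_near. Qed.
End ComplexLimits.

(** * Kernel functions, their volumes, and the choice of sampling points *)

Section Kernel.
Variables (R : realType) (D : Type) (K : D -> D -> R[i]) (H : rkhs K).
Local Notation "''[' f , g ]" := (rkhs_dot H f g) : ring_scope.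
Local Notation "''[' f ]" := (rkhs_dot H f f) : ring_scope.

Definition kern (y : D) : H := sval (cid (rkhs_reproducing H y)).

Lemma kern_eval y : rkhs_eval (kern y) = K ^~ y.
Proof. by rewrite /kern; case: cid => k []. Qed.

Lemma eval_dot f y : rkhs_eval f y = '[f, kern y].
Proof. by rewrite /kern; case: cid => k []. Qed.

Lemma dot_kern x y : '[kern y, kern x] = K x y.
Proof. by rewrite -eval_dot kern_eval. Qed.

Variable e : nat -> D -> R[i].
Hypothesis Kcvg : forall x y,
  (fun n => \sum_(0 <= k < n) e k x * (e k y)^* : R[i]^o) @ \oo -->
  (K x y : R[i]^o).

(** The squared norm is a finite double sum of kernel values, each the limit of its series. This
    acts as Parseval's identity without placing the [e k] in [H]. *)
Lemma kern_comb_cvg m (y : 'I_m -> D) (z : 'rV[R[i]]_m) :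
  (fun n => \sum_(0 <= k < n) `|\sum_i z 0 i * (e k (y i))^*| ^+ 2 : R[i]^o)
    @ \oo --> ('[\sum_i z 0 i *: kern (y i)] : R[i]^o).
Proof.
have -> : '[\sum_i z 0 i *: kern (y i)] =
    \sum_i \sum_j z 0 i * (z 0 j)^* * K (y j) (y i).
  rewrite [LHS](linear_sumlz (rkhs_dot H)); apply: eq_bigr => i _.
  rewrite [LHS](linear_sumr (rkhs_dot H)); apply: eq_bigr => j _.
  rewrite -dot_kern [LHS](linearZr_LR (rkhs_dot H)) /=.
  by rewrite [X in _ * X](linearZl_LR (rkhs_dot H)) /= mulrCA mulrA.
have -> : (fun n => \sum_(0 <= k < n) `|\sum_i z 0 i * (e k (y i))^*| ^+ 2) =
    (fun n => \sum_i \sum_j z 0 i * (z 0 j)^* *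
                \sum_(0 <= k < n) e k (y j) * (e k (y i))^*).
  apply/funext => n.
  under eq_bigr => k _.
    rewrite normCK rmorph_sum mulr_suml.
    under eq_bigr do rewrite mulr_sumr.
    over.
  rewrite exchange_big; apply: eq_bigr => i _.
  rewrite exchange_big; apply: eq_bigr => j _.
  rewrite mulr_sumr; apply: eq_bigr => k _.
  by rewrite rmorphM /= conjCK; ring.
apply: (@cvg_big R[i]^o) => [|i _]; first exact: add_continuous.
apply: (@cvg_big R[i]^o) => [|j _]; first exact: add_continuous.
exact: cvgMl_tmp.
Qed.

Lemma kern_bessel m (y : 'I_m -> D) (z : 'rV[R[i]]_m) N :
  \sum_(k < N) `|\sum_i z 0 i * (e k (y i))^*| ^+ 2
    <= '[\sum_i z 0 i *: kern (y i)].
Proof.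
rewrite -(big_mkord predT (fun k => `|\sum_i z 0 i * (e k (y i))^*| ^+ 2)).
apply: (cvgC_ge _ _ (@kern_comb_cvg _ y z)).
- by rewrite ger0_real ?sumr_ge0.
- by rewrite ger0_real ?dot_ge0.
near=> n; have Nn : (N <= n)%N by near: n; exact: nbhs_infty_ge.
by rewrite (big_cat_nat _ Nn)//= lerDl sumr_ge0.
Unshelve. all: by end_near. Qed.

Lemma kern_tail_le n (t : R[i]) x : 0 <= t ->
  (forall N, \sum_(n <= k < N) `|e k x| ^+ 2 <= t) ->
  '[kern x] - \sum_(k < n) `|e k x| ^+ 2 <= t.
Proof.
move=> t0 et; rewrite lerBlDr.
have sum0 : 0 <= \sum_(k < n) `|e k x| ^+ 2 by rewrite sumr_ge0.
apply: (@cvgC_le _ (fun n => \sum_(0 <= k < n) `|e k x| ^+ 2)).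
- by rewrite ger0_real ?addr_ge0.
- by rewrite ger0_real ?dot_ge0.
- rewrite dot_kern; under eq_fun do under eq_bigr do rewrite normCK.
  exact: Kcvg.
near=> N; have nN : (n <= N)%N by near: N; exact: nbhs_infty_ge.
by rewrite (big_cat_nat _ nN)//= big_mkord addrC lerD2r.
Unshelve. all: by end_near. Qed.

Variable x0 : D.
Local Notation kdet s := (gdet (rkhs_dot H) [seq kern x | x <- s]).

(** The conjugated first [n] coordinates of the kernel functions form [V]; Bessel's inequality and
    the tail bound supply the hypotheses of [gdet_codim_le]. *)
Lemma kdet_codim_le n m (t M : R[i]) (s : seq D) : 0 <= t -> 0 <= M ->
  (forall x N, \sum_(n <= k < N) `|e k x| ^+ 2 <= t) ->
  size s = m ->
  (forall s', (size s' <= n)%N -> kdet s' * t ^+ (m - size s') <= M) ->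
  kdet s <= 4 ^+ m * M.
Proof.
move=> t0 M0 et sm sM.
pose y (i : 'I_m) := nth x0 s i.
pose V : 'M[R[i]]_(m, n) := \matrix_(i, k) (e k (y i))^*.
have dotV (u : 'rV_n) : (u *m u ^t*)%sesqui 0 0 = \sum_k `|u 0 k| ^+ 2.
  by rewrite mxE; apply: eq_bigr => k _; rewrite !mxE normCK.
have -> : map kern s = map (kern \o y) (enum 'I_m).
  rewrite map_comp; congr map; apply: (@eq_from_nth _ x0).
    by rewrite size_map size_enum_ord.
  move=> i; rewrite sm => im.
  by rewrite (nth_map (Ordinal im)) ?size_enum_ord// /y nth_enum_ord.
apply: (@gdet_codim_le _ _ (rkhs_dot H) _ n _ V t) => //.
- move=> z; rewrite dotV; apply: le_trans (kern_bessel y z n).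
  by under eq_bigr do [rewrite mxE; under eq_bigr do rewrite mxE].
- move=> i; rewrite dotV; under eq_bigr do rewrite !mxE norm_conjC.
  exact: kern_tail_le.
- move=> s' ns'; have := sM (map y s'); rewrite size_map -map_comp; exact.
Qed.

(* Near-maximal volumes: if the supremum [a p] of the Gram determinants over
   [p] points grew by a factor larger than [16 t] at each of the first [2 n]
   steps, then [a (2 n)] would exceed the bound of [kdet_codim_le]. *)
Lemma exists_sampling_points n (t kappa : R) : (0 < n)%N -> 0 <= t ->
  (forall x, '[kern x] <= kappa%:C) ->
  (forall x N, \sum_(n <= k < N) `|e k x| ^+ 2 <= t%:C) ->
  exists s : seq D, [/\ (size s < 2 * n)%N, 0 < kdet s &
    forall x, kdet (x :: s) <= (32 * t)%:C * kdet s].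
Proof.
move=> n0 t0 kx et.
pose g s := complex.Re (kdet s).
have gE s : kdet s = (g s)%:C by rewrite RRe_real// ger0_real ?gdet_ge0.
have g0 s : 0 <= g s by rewrite -ler0c -gE gdet_ge0.
have kappa0 : 0 <= kappa by rewrite -ler0c; apply: le_trans (kx x0); rewrite dot_ge0.
pose E p := [set g s | s in [set s | size s = p]].
pose a p := sup (E p).
(* Hadamard's inequality makes the suprema [a p] finite. *)
have gk s : g s <= kappa ^+ size s.
  elim: s => [|x s IH]; first by rewrite /g /= gdet_nil.
  rewrite -lecR -gE /=; apply: le_trans (gdet_cons_norm _ _ _) _.
  rewrite exprS rmorphM /= gE; apply: ler_pM; rewrite ?ler0c ?dot_ge0//.
  by rewrite lecR.
have supE p : has_sup (E p).
  split; first by exists (g (nseq p x0)); exists (nseq p x0) => //=; rewrite size_nseq.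
  by exists (kappa ^+ p) => _ [s <- <-].
have ga s p : size s = p -> g s <= a p.
  by move=> sp; apply: sup_upper_bound => //; exists s.
have a0 p : 0 <= a p by apply: le_trans (ga (nseq p x0) p _); rewrite ?size_nseq.
have [ex|] := pselect (exists p, (a p.+1 <= 16 * t * a p) && (p < 2 * n)%N).
  case: (ex_minnP ex) => p /andP[ap pn] pmin.
  (* By minimality of [p] the preceding step grows strictly, which forces [a p > 0] even if [t = 0];
     for [p = 0] the empty list has determinant 1. *)
  have ap0 : 0 < a p.
    case: p ap pn pmin => [|q] ap qn qmin.
      by apply: lt_le_trans (ga [::] 0%N _); rewrite // /g /= gdet_nil.
    have : ~~ ((a q.+1 <= 16 * t * a q) && (q < 2 * n)%N).
      by apply/negP => /qmin; rewrite ltnn.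
    rewrite (ltn_trans _ qn)// andbT -ltNge; apply: le_lt_trans.
    by rewrite !mulr_ge0.
  (* A volume above half the supremum; together with the growth factor [16 t] this gives [32 t]. *)
  have [_ [s sp <-] gs] := sup_adherent (divr_gt0 ap0 (ltr0n _ 2)) (supE p).
  rewrite -/(a p) in gs; have {}gs : a p < 2 * g s by lra.
  exists s; split; first by rewrite sp.
    by rewrite gE ltcR; lra.
  move=> x; rewrite !gE -rmorphM lecR.
  apply: (le_trans (ga (x :: s) p.+1 _)); first by rewrite /= sp.
  apply: (le_trans ap); rewrite (_ : 32 * t * g s = 16 * t * (2 * g s)); last by ring.
  by rewrite ler_wpM2l ?mulr_ge0// ltW.
move=> /forallNP na; exfalso.
have {}na p : (p < 2 * n)%N -> 16 * t * a p < a p.+1.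
  by move=> pn; rewrite ltNge; apply/negP => ap; apply: (na p); rewrite ap.
have up p j : (p + j <= 2 * n)%N -> (16 * t) ^+ j * a p <= a (p + j)%N.
  elim: j => [|j IH] pj; first by rewrite expr0 mul1r addn0.
  rewrite addnS in pj *; apply: le_trans (ltW (na _ pj)).
  by rewrite exprS -mulrA ler_wpM2l ?mulr_ge0// IH// ltnW.
have upt p j : (p + j <= 2 * n)%N -> t ^+ j * a p <= a (p + j)%N.
  move=> /up; apply: le_trans; rewrite ler_wpM2r// lerXn2r ?nnegrE ?mulr_ge0//.
  by lra.
(* Here [4 ^+ (2 * n)] is [16 ^+ n]. The exponent [2 n - size s'] splits into [n], kept as [t ^+ n],
   and [n - size s'], which lifts [a (size s')] to [a n]. *)
have a2n : a (2 * n)%N <= 4 ^+ (2 * n) * (a n * t ^+ n).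
  apply: ge_sup; first exact: (supE _).1.
  move=> _ [s s2n <-]; rewrite -lecR -gE rmorphM rmorphXn /= rmorph_nat.
  apply: (@kdet_codim_le n _ t%:C); rewrite ?ler0c ?mulr_ge0 ?exprn_ge0//.
  move=> s' s'n; rewrite gE -rmorphXn -rmorphM lecR.
  have -> : (2 * n - size s' = (n - size s') + n)%N by lia.
  rewrite exprD mulrA ler_wpM2r ?exprn_ge0// mulrC.
  apply: le_trans (_ : t ^+ (n - size s') * a (size s') <= _).
    by rewrite ler_wpM2l ?exprn_ge0 ?ga.
  by apply: le_trans (upt (size s') (n - size s')%N _) _; rewrite subnKC//; lia.
(* A single strict growth step, the last one, suffices for the contradiction. *)
have : 16 * t * a (2 * n).-1 < a (2 * n)%N.
  by have := na (2 * n).-1; rewrite prednK; [apply|]; lia.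
have : (16 * t) ^+ n.-1 * a n <= a (2 * n).-1.
  by have := up n n.-1; rewrite (_ : n + n.-1 = (2 * n).-1)%N; [apply|]; lia.
move=> /(ler_wpM2l (mulr_ge0 (ler0n R 16) t0)); rewrite mulrA -exprS prednK//.
move=> /le_lt_trans h /h; apply/negP; rewrite -leNgt; apply: le_trans a2n _.
by rewrite exprM -natrX exprMn -mulrA (mulrC (a n)).
Qed.

(** Total in [i] with value 0 past the end of [s], so that [s] can serve for any larger number of
    sample points. *)
Definition sampling_coef (s : seq D) x (i : nat) : R[i] :=
  if insub i is Some j then gram_coef (rkhs_dot H) (map kern s) (kern x) 0 j else 0.

(** If the Gram matrix is invertible, its norm is the power function of interpolation at [s]: the
    distance of [kern x] to the span of the kernel functions. *)
Definition residual (s : seq D) x : H :=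
  kern x - \sum_(i < size s) sampling_coef s x i *: kern (nth x0 s i).

Lemma residualE s x : residual s x =
  kern x - lincomb (map kern s) (gram_coef (rkhs_dot H) (map kern s) (kern x)).
Proof.
rewrite /residual /lincomb; congr (_ - _).
rewrite -(size_map kern s); apply: eq_bigr => i _.
rewrite /sampling_coef valK (nth_map x0)//.
by case: i => i /=; rewrite size_map.
Qed.

Lemma dot_residual s x : kdet s != 0 ->
  '[residual s x] * kdet s = kdet (x :: s).
Proof. by move=> s0; rewrite residualE /= gdet_cons_coef// mulrC. Qed.

(** The pointwise error of the sampling formula is an inner product, so Cauchy-Schwarz bounds it by
    the norm of [f] times that of the residual. *)
Lemma eval_residual s f x : '[f, residual s x] =
  rkhs_eval f x - \sum_(i < size s) rkhs_eval f (nth x0 s i) * (sampling_coef s x i)^*.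
Proof.
rewrite /residual dotBr -eval_dot; congr (_ - _).
rewrite [LHS](linear_sumr (rkhs_dot H)); apply: eq_bigr => i _.
by rewrite [LHS](linearZr_LR (rkhs_dot H)) /= eval_dot mulrC.
Qed.
End Kernel.

Lemma sum_ord_pad (V : nmodType) m N (F : nat -> V) : (m <= N)%N ->
  (forall i, (m <= i)%N -> F i = 0) -> \sum_(i < N) F i = \sum_(i < m) F i.
Proof.
move=> mN F0; rewrite (big_ord_widen N F mN) [RHS]big_mkcond.
by apply: eq_bigr => i _; case: ltnP => // /F0.
Qed.

Section Sup.
Variables (R : realType) (D : pointedType).

Lemma supnorm_le (f : D -> R[i]) (r : R) :
  (forall x, `|f x| <= r%:C) -> (supnorm f <= r%:E)%E.
Proof.
by move=> fr; apply: ge_ereal_sup => _ [x _ <-]; rewrite lee_fin -lecR; exact: fr.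
Qed.

Lemma le_supnorm (f : D -> R[i]) x : ((normc (f x))%:E <= supnorm f)%E.
Proof. by apply: ereal_sup_ubound; exists x. Qed.

Lemma Linfty_bounded (f : D -> R[i]) (r : R) :
  (forall x, `|f x| <= r%:C) -> Linfty f.
Proof. by move=> /supnorm_le fr; apply: le_lt_trans fr (ltry r). Qed.
End Sup.

(** * From residual norms to linear sampling numbers *)

Section Sampling.
Variables (R : realType) (D : pointedType) (K : D -> D -> R[i]) (H : rkhs K).
Local Notation "''[' f , g ]" := (rkhs_dot H f g) : ring_scope.
Local Notation "''[' f ]" := (rkhs_dot H f f) : ring_scope.
Local Notation kern := (@kern R D K H).
Local Notation kdet s := (gdet (rkhs_dot H) [seq kern x | x <- s]).
Local Notation residual := (@residual R D K H point).
Local Notation sampling_coef := (@sampling_coef R D K H).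

Variable kappa : R.
Hypothesis kx : forall x, '[kern x] <= kappa%:C.

Lemma kappa_ge0 : 0 <= kappa.
Proof. by rewrite -ler0c; apply: le_trans (kx point); rewrite dot_ge0. Qed.

Lemma unit_ballE (f : H) : unit_ball f -> '[f] <= 1.
Proof. by move=> f1; rewrite -rkhs_normE expr_le1. Qed.

Lemma eval_bounded f x : `|rkhs_eval f x| <= sqrtC ('[f] * kappa%:C).
Proof.
rewrite eval_dot -(@ler_pXn2r _ 2)// ?nnegrE ?sqrtC_ge0 ?mulr_ge0 ?dot_ge0 ?ler0c ?kappa_ge0//.
rewrite sqrtCK; apply: le_trans (dot_CauchySchwarz _ _ _) _.
by rewrite ler_wpM2l ?dot_ge0.
Qed.

Lemma rkhs_sub_Linfty : rkhs_functions H `<=` @Linfty R D.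
Proof.
move=> _ [f _ <-]; pose c := sqrtC ('[f] * kappa%:C).
have c0 : 0 <= c by rewrite sqrtC_ge0 mulr_ge0 ?dot_ge0 ?ler0c ?kappa_ge0.
apply: (@Linfty_bounded _ _ _ (complex.Re c)) => x.
by rewrite RRe_real ?ger0_real// eval_bounded.
Qed.

(** Admissibility of the weights: each is a fixed combination of inner products of kernel functions,
    which are at most [kappa] in modulus. *)
Lemma sampling_coef_Linfty s i : Linfty (fun x => (sampling_coef s x i)^*).
Proof.
rewrite /sampling_coef; case: insubP => [j _ _|_]; last first.
  by apply: (@Linfty_bounded _ _ _ 0) => x; rewrite norm_conjC normr0.
pose c := \sum_k kappa%:C * `|invmx (gram (rkhs_dot H) (map kern s)) k j|.
have c0 : 0 <= c by apply: sumr_ge0 => k _; apply: mulr_ge0 => //; rewrite ler0c kappa_ge0.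
apply: (@Linfty_bounded _ _ _ (complex.Re c)) => x.
rewrite RRe_real ?ger0_real// norm_conjC mxE; apply: le_trans (ler_norm_sum _ _ _) _.
apply: ler_sum => k _; rewrite normrM ler_wpM2r//.
rewrite mxE; have [y ->] : exists y, (map kern s)`_k = kern y.
  by exists (nth point s k); rewrite (nth_map point)// -(size_map kern).
rewrite -(@ler_pXn2r _ 2)// ?nnegrE ?ler0c ?kappa_ge0//.
apply: le_trans (dot_CauchySchwarz _ _ _) _.
by rewrite expr2 ler_pM ?dot_ge0.
Qed.

Lemma sampling_number_le (s : seq D) (N : nat) (r : R) :
  (size s <= N)%N -> 0 <= r -> (forall x, '[residual s x] <= (r ^+ 2)%:C) ->
  (rkhs_lin_sampling_number N H (@Linfty R D) (@supnorm R D) <= r%:E)%E.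
Proof.
move=> sN r0 sr; pose phi (i : 'I_N) x := (sampling_coef s x i)^*.
apply: ge_ereal_inf; exists (ereal_sup [set supnorm (fun y => f y -
   \sum_(i < N) f (nth point s i) * phi i y) | f in rkhs_eval (r:=H) @` @unit_ball R H]).
  by exists ((fun i : 'I_N => nth point s i), phi) => // i; exact: sampling_coef_Linfty.
apply: ge_ereal_sup => _ [_ [f /unit_ballE f1 <-] <-]; apply: supnorm_le => x.
(* Surplus nodes equal [point], the default of [nth], and carry weight 0. *)
have -> : \sum_(i < N) rkhs_eval f (nth point s i) * phi i x =
    \sum_(i < size s) rkhs_eval f (nth point s i) * (sampling_coef s x i)^*.
  pose F i := rkhs_eval f (nth point s i) * (sampling_coef s x i)^*.
  apply: (@sum_ord_pad _ _ _ F sN) => i si.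
  rewrite /F /sampling_coef insubF ?conjC0 ?mulr0// size_map.
  by apply/negbTE; rewrite -leqNgt.
rewrite -eval_residual -(@ler_pXn2r _ 2)// ?nnegrE ?ler0c//.
apply: le_trans (dot_CauchySchwarz _ _ _) _.
rewrite -[leRHS]mul1r -rmorphXn; apply: ler_pM; rewrite ?dot_ge0//.
Qed.
End Sampling.

(** * Tails of a summable sequence and summation by parts *)

Section Tails.
Variables (R : realType) (a : nat -> R).
Hypotheses (a0 : forall k, 0 <= a k) (asum : (\sum_(0 <= k <oo) (a k)%:E < +oo)%E).

Definition tail n : R := fine (\sum_(n <= k <oo) (a k)%:E)%E.

Lemma partial_le_series n N : ((\sum_(n <= k < N) a k)%:E <= \sum_(n <= k <oo) (a k)%:E)%E.
Proof. by rewrite -sumEFin; apply: nneseries_lim_ge => k _ _; rewrite lee_fin. Qed.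

Lemma series_le n (c : \bar R) :
  (forall N, ((\sum_(n <= k < N) a k)%:E <= c)%E) -> (\sum_(n <= k <oo) (a k)%:E <= c)%E.
Proof.
move=> ac; apply: lime_le; first by apply: is_cvg_nneseries => k _ _; rewrite lee_fin.
by apply: nearW => N; rewrite sumEFin.
Qed.

Lemma tailE n : (\sum_(n <= k <oo) (a k)%:E = (tail n)%:E)%E.
Proof.
rewrite /tail fineK// ge0_fin_numE; last by apply: nneseries_ge0 => k _ _; rewrite lee_fin.
apply: le_lt_trans asum; apply: series_le => N.
apply: le_trans (partial_le_series 0 N); rewrite lee_fin.
have [nN|Nn] := leqP n N; last by rewrite big_geq ?sumr_ge0// ltnW.
by rewrite [leRHS](big_cat_nat _ nN)//= lerDr sumr_ge0.
Qed.

Lemma partial_le_tail n N : \sum_(n <= k < N) a k <= tail n.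
Proof. by rewrite -lee_fin -tailE partial_le_series. Qed.

Lemma tail_ge0 n : 0 <= tail n.
Proof. by apply: le_trans (partial_le_tail n 0); rewrite big_geq. Qed.

Lemma tail_small eps : 0 < eps -> exists2 n, (0 < n)%N & tail n < eps.
Proof.
move=> e0.
have := @nneseries_tail_cvg _ (fun k => (a k)%:E) predT asum (fun k _ => a0 k).
move=> /fine_cvgP[_] /cvgrPdist_lt /(_ _ e0)[N _ NP]; exists N.+1 => //.
have := NP N.+1 (leqnSn N); rewrite /= sub0r normrN ger0_norm//.
exact: tail_ge0.
Qed.

Hypothesis a_anti : forall j k, (j <= k)%N -> a k <= a j.
Variables (beta : nat -> R) (B : R).
Hypotheses (B0 : 0 <= B) (beta0 : forall k, 0 <= beta k)
  (betaB : forall n, \sum_(k < n) beta k <= n%:R * B).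

Lemma abel_sum m N : \sum_(m <= k < N) a k * beta k
  <= B * (m%:R * a m + \sum_(m <= k < N) a k).
Proof.
have [mN|Nm] := leqP m N; last by rewrite !big_geq 1?ltnW// addr0 !mulr_ge0.
(* Strengthened for the induction: the boundary term of summation by parts is kept, and [betaB]
   makes it nonnegative. *)
suff: \sum_(m <= k < N) a k * beta k + a N * (N%:R * B - \sum_(k < N) beta k)
    <= B * (m%:R * a m + \sum_(m <= k < N) a k).
  by apply: le_trans; rewrite lerDl mulr_ge0// subr_ge0.
rewrite -(subnKC mN); elim: (N - m)%N => [|j].
  rewrite addn0 !big_geq// add0r addr0 (_ : B * _ = a m * (m%:R * B)); last by ring.
  rewrite ler_wpM2l//.
  by rewrite gerBl sumr_ge0.
rewrite addnS; set M := (m + j)%N => IH.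
have mM : (m <= M)%N by rewrite leq_addr.
rewrite !(big_nat_recr M)//= big_ord_recr /=.
have aM : a M.+1 * (M.+1%:R * B - (\sum_(k < M) beta k + beta M))
    <= a M * (M.+1%:R * B - (\sum_(k < M) beta k + beta M)).
  by rewrite ler_wpM2r ?a_anti// subr_ge0; have := betaB M.+1; rewrite big_ord_recr.
by move: IH aM; rewrite -!natr1; lra.
Qed.

(** Starting at [2 n] lets the term [2 n a(2 n)] of [abel_sum] be absorbed by twice the block from
    [n] to [2 n]. *)
Lemma abel_tail n N : \sum_(2 * n <= k < N) a k * beta k <= 2 * B * tail n.
Proof.
apply: le_trans (abel_sum _ _) _.
rewrite (mulrC 2) -mulrA ler_wpM2l//.
have nN : n%:R * a (2 * n)%N <= \sum_(n <= k < 2 * n) a k.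
  have -> : n%:R * a (2 * n)%N = \sum_(n <= k < 2 * n) a (2 * n)%N.
    by rewrite sumr_const_nat mul2n -addnn addnK mulr_natl.
  by apply: ler_sum_nat => k /andP[_ kn]; rewrite a_anti// ltnW.
have n2n : (n <= 2 * n)%N by lia.
have tN : \sum_(n <= k < 2 * n) a k + \sum_(2 * n <= k < N) a k <= tail n.
  have [h|h] := leqP (2 * n) N.
    by rewrite -big_cat_nat// partial_le_tail.
  by rewrite [X in _ + X]big_geq ?addr0 ?partial_le_tail// ltnW.
have := partial_le_tail n (2 * n).
have t0 : 0 <= \sum_(2 * n <= k < N) a k by apply: sumr_ge0.
rewrite natrM; lra.
Qed.
End Tails.

(** * The sampling bound for a system with bounded averages *)

Section BoundedSystem.
Variables (R : realType) (D : pointedType) (K : D -> D -> R[i]) (H : rkhs K).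
Variables (sigma : nat -> R) (b : nat -> D -> R[i]) (B : R).
Hypotheses (sigma0 : forall k, 0 <= sigma k)
  (sigma_anti : forall j k, (j <= k)%N -> sigma k <= sigma j)
  (sigma_sum : (\sum_(0 <= k <oo) (sigma k ^+ 2)%:E < +oo)%E).
Hypothesis Kcvg : forall x y,
  (fun n => \sum_(0 <= k < n) (sigma k ^+ 2)%:C * b k x * (b k y)^* : R[i]^o)
    @ \oo --> (K x y : R[i]^o).
Hypotheses (B0 : 0 < B) (bB : forall n, (0 < n)%N ->
  (supnorm (fun x : D => (n%:R^-1 * \sum_(k < n) normc (b k x) ^+ 2)%:C)
     <= B%:E)%E).

Local Notation a := (fun k => sigma k ^+ 2).
Local Notation tail := (tail a).
Local Notation dot := (rkhs_dot H).
Local Notation kern := (@kern R D K H).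
Local Notation kdet s := (gdet (rkhs_dot H) [seq kern x | x <- s]).
Local Notation residual := (@residual R D K H point).

Let a0 k : 0 <= a k. Proof. exact: sqr_ge0. Qed.

Let a_anti j k : (j <= k)%N -> a k <= a j.
Proof. by move=> jk; rewrite lerXn2r ?nnegrE ?sigma_anti. Qed.

Definition scaled_basis k x : R[i] := (sigma k)%:C * b k x.
Local Notation e := scaled_basis.

Lemma norm_scaled_basis k x : `|e k x| ^+ 2 = (a k * normc (b k x) ^+ 2)%:C.
Proof.
by rewrite normrM exprMn (ger0_norm (_ : 0 <= (sigma k)%:C)) ?ler0c// -!rmorphXn -rmorphM.
Qed.

Lemma scaled_basis_cvg x y :
  (fun n => \sum_(0 <= k < n) e k x * (e k y)^* : R[i]^o) @ \oo --> (K x y : R[i]^o).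
Proof.
have -> : (fun n => \sum_(0 <= k < n) e k x * (e k y)^* : R[i]^o) =
    (fun n => \sum_(0 <= k < n) (sigma k ^+ 2)%:C * b k x * (b k y)^* : R[i]^o).
  apply/funext => n; apply: eq_bigr => k _.
  rewrite /e rmorphM /= conj_Creal ?complex_real//.
  by rewrite rmorphXn /= expr2; ring.
exact: Kcvg.
Qed.

Lemma sum_normb_le x n : \sum_(k < n) normc (b k x) ^+ 2 <= n%:R * B.
Proof.
have [->|n0] := posnP n; first by rewrite big_ord0 mul0r.
have := le_trans (le_supnorm _ x) (bB n0); rewrite lee_fin.
set S := \sum_(k < n) _; move=> nS.
have {}nS : n%:R^-1 * S <= B.
  apply: le_trans nS; rewrite -lecR; apply: le_trans (real_ler_norm _) _ => //.
  by rewrite complex_real.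
by rewrite -ler_pdivrMl ?ltr0n.
Qed.

Lemma scaled_basis_tail_le x n N :
  \sum_(2 * n <= k < N) `|e k x| ^+ 2 <= (2 * B * tail n)%:C.
Proof.
under eq_bigr do rewrite norm_scaled_basis.
rewrite -rmorph_sum lecR.
apply: (abel_tail a0 sigma_sum a_anti (beta := fun k => normc (b k x) ^+ 2) (ltW B0)).
  by move=> k; exact: sqr_ge0.
exact: sum_normb_le.
Qed.

Lemma dot_kern_le x : dot (kern x) (kern x) <= (2 * B * tail 0)%:C.
Proof.
have t0 := tail_ge0 a0 sigma_sum 0.
have := @kern_tail_le R D K H e scaled_basis_cvg 0 (2 * B * tail 0)%:C x.
rewrite big_ord0 subr0; apply; first by rewrite ler0c !mulr_ge0// ltW.
by move=> N; exact: (scaled_basis_tail_le x 0).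
Qed.

Lemma bounded_sampling_points n : (0 < n)%N -> exists s : seq D,
  [/\ (size s < 4 * n)%N, 0 < kdet s &
      forall x, dot (residual s x) (residual s x) <= (64 * B * tail n)%:C].
Proof.
move=> n0; have t0 := tail_ge0 a0 sigma_sum n.
have n20 : (0 < 2 * n)%N by lia.
have t20 : 0 <= 2 * B * tail n by rewrite !mulr_ge0// ltW.
(* Applied with [2 n] in place of [n]: fewer than [4 n] points, and squared distances at most [32]
   times [2 B tail n]. *)
have [s [sn s0 sP]] := exists_sampling_points scaled_basis_cvg point n20 t20
  dot_kern_le (fun x => @scaled_basis_tail_le x n).
exists s; split=> //; first by apply: leq_trans sn _; lia.
move=> x; rewrite -(ler_pM2r s0) dot_residual ?gt_eqF//.
by apply: le_trans (sP x) _; rewrite !mulrA -natrM.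
Qed.

Lemma rkhs_functions_Linfty : rkhs_functions H `<=` @Linfty R D.
Proof. exact: rkhs_sub_Linfty dot_kern_le. Qed.

Local Notation g n := (rkhs_lin_sampling_number n H (@Linfty R D) (@supnorm R D)).

(** The class contains the zero function. Nonnegativity is what allows the bound to be squared. *)
Lemma sampling_number_ge0 n : (0 <= g n)%E.
Proof.
apply: le_ereal_inf_tmp => _ [xphi _ <-].
apply: (@le_trans _ _ (supnorm (fun y => (rkhs_eval (0 : H) y) -
   \sum_(i < n) rkhs_eval (0 : H) (xphi.1 i) * xphi.2 i y))).
  by apply: le_trans (le_supnorm _ point); rewrite lee_fin; case: (_ - _) => ? ?; exact: sqrtr_ge0.
apply: ereal_sup_ubound; exists (rkhs_eval (0 : H)) => //.
by exists 0 => //; rewrite /unit_ball /= normr0.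
Qed.

Lemma sampling_number_tail n : (0 < n)%N ->
  (g (4 * n) <= (Num.sqrt (B * 64%:R * tail n))%:E)%E.
Proof.
move=> n0; have [s [sn s0 sP]] := bounded_sampling_points n0.
apply: (sampling_number_le dot_kern_le (s := s)); rewrite ?sqrtr_ge0// 1?ltnW// => x.
rewrite sqr_sqrtr; last by rewrite !mulr_ge0 ?tail_ge0// ltW.
by rewrite (mulrC B).
Qed.

Lemma sampling_number_tail_sqr n : (0 < n)%N ->
  (g (4 * n) ^+ 2 <= (B * 64%:R)%:E * \sum_(n <= k <oo) (a k)%:E)%E.
Proof.
move=> n0; rewrite tailE//.
have t0 : 0 <= B * 64%:R * tail n by rewrite !mulr_ge0 ?tail_ge0// ltW.
rewrite -EFinM -(sqr_sqrtr t0) -[leRHS]/(_%:E ^+ 2)%E.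
by rewrite lee_sqr ?sampling_number_ge0 ?lee_fin ?sqrtr_ge0// sampling_number_tail.
Qed.
End BoundedSystem.

Lemma CauchySchwarz_sum (C : numClosedFieldType) n (u v : 'I_n -> C) :
  `|\sum_k u k * v k| ^+ 2 <= (\sum_k `|u k| ^+ 2) * (\sum_k `|v k| ^+ 2).
Proof.
have dE (x y : 'I_n -> C) : dotmx (\row_k x k) (\row_k y k) = \sum_k x k * (y k)^*.
  by rewrite dotmxE mxE; apply: eq_bigr => k _; rewrite !mxE.
pose u' := \row_k u k; pose v' := \row_k (v k)^*.
have : `|dotmx u' v'| ^+ 2 <= dotmx u' u' * dotmx v' v' by exact: dot_CauchySchwarz.
rewrite !dE; congr (_ <= _ * _); first congr (`|_| ^+ 2).
- by apply: eq_bigr => k _; rewrite conjCK.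
- by apply: eq_bigr => k _; rewrite normCK.
- by apply: eq_bigr => k _; rewrite conjCK normCK mulrC.
Qed.

(** * Replacing finite expansions in the [e k] by interpolants in [H] *)

Section Interpolation.
Variables (R : realType) (D : pointedType) (K : D -> D -> R[i]) (H : rkhs K).
Variable e : nat -> D -> R[i].
Hypothesis Kcvg : forall x y,
  (fun n => \sum_(0 <= k < n) e k x * (e k y)^* : R[i]^o) @ \oo -->
  (K x y : R[i]^o).
Variables (s : seq D) (N : nat).
Local Notation dot := (rkhs_dot H).
Local Notation kern := (@kern R D K H).
Local Notation residual := (@residual R D K H point s).
Local Notation m := (size (map kern s)).
Hypothesis s0 : gdet dot (map kern s) != 0.

Let y (i : 'I_m) := nth point s i.
Let yE (i : 'I_m) : (map kern s)`_i = kern (y i).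
Proof. by rewrite (nth_map point)// -(size_map kern). Qed.

Let c x := gram_coef dot (map kern s) (kern x).
Let Ginv := invmx (gram dot (map kern s)).

Let residual_c x : residual x = kern x - \sum_i c x 0 i *: kern (y i).
Proof. by rewrite residualE /lincomb; under eq_bigr do rewrite yE. Qed.

Definition expansion (a : 'rV[R[i]]_N) x := \sum_k a 0 k * e k x.

(** The combination of kernel functions that agrees with [e k] at the nodes. It stands in for [e k],
    which is not assumed to lie in [H], so that information maps on [H] can be applied. *)
Definition interpolant_basis (k : 'I_N) : H :=
  \sum_i (\sum_j e k (y j) * (Ginv i j)^*) *: kern (y i).

Definition interpolant (a : 'rV[R[i]]_N) : H := \sum_k a 0 k *: interpolant_basis k.

Let eval_basis k x :
  rkhs_eval (interpolant_basis k) x = \sum_j e k (y j) * (c x 0 j)^*.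
Proof.
rewrite eval_dot [LHS](linear_sumlz dot).
under [RHS]eq_bigr => j _.
  rewrite mxE rmorph_sum mulr_sumr.
  under eq_bigr do rewrite mxE rmorphM /= -dotC yE.
  over.
rewrite exchange_big; apply: eq_bigr => i _.
rewrite [LHS](linearZl_LR dot) /= mulr_suml; apply: eq_bigr => j _.
by rewrite mulrAC mulrA.
Qed.

Let bessel_residual x : \sum_(k < N) `|e k x - \sum_j e k (y j) * (c x 0 j)^*| ^+ 2
  <= dot (residual x) (residual x).
Proof.
(* Coefficients of [residual x] on the point [x] followed by the nodes: 1 at [x] and [- c x] at the
   nodes. *)
pose z : 'rV[R[i]]_m.+1 := \row_i (if unlift ord0 i is Some j then - c x 0 j else 1).
pose w (i : 'I_m.+1) := if unlift ord0 i is Some j then y j else x.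
have := kern_bessel H Kcvg w z N.
have -> : \sum_i z 0 i *: kern (w i) = residual x.
  rewrite big_ord_recl residual_c !mxE /w unlift_none scale1r -sumrN.
  by congr (_ + _); apply: eq_bigr => i _; rewrite mxE liftK scaleNr.
apply: le_trans; rewrite le_eqVlt; apply/orP; left; apply/eqP.
apply: eq_bigr => k _; rewrite -norm_conjC; congr (`|_| ^+ 2).
rewrite big_ord_recl !mxE /w unlift_none mul1r rmorphB; congr (_ + _).
rewrite rmorph_sum -sumrN; apply: eq_bigr => i _.
by rewrite [z 0 _]mxE liftK rmorphM /= conjCK mulNr mulrC.
Qed.

Lemma interpolant_error a x : `|expansion a x - rkhs_eval (interpolant a) x| ^+ 2
  <= (\sum_k `|a 0 k| ^+ 2) * dot (residual x) (residual x).
Proof.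
have -> : expansion a x - rkhs_eval (interpolant a) x =
    \sum_k a 0 k * (e k x - \sum_j e k (y j) * (c x 0 j)^*).
  rewrite eval_dot [X in _ - X](linear_sumlz dot) -sumrB; apply: eq_bigr => k _.
  by rewrite [X in _ - X](linearZl_LR dot) /= -eval_dot eval_basis mulrBr.
apply: le_trans (CauchySchwarz_sum _ _) _; rewrite ler_wpM2l ?sumr_ge0//.
Qed.

Let interpolant_node a i : rkhs_eval (interpolant a) (y i) = expansion a (y i).
Proof.
(* [kern (y i)] is one of the vectors projected onto, so its distance to the span is 0. *)
have r0 : dot (residual (y i)) (residual (y i)) = 0.
  apply/eqP; rewrite eq_le dot_ge0 andbT.
  have := dist_lincomb (kern (y i)) (delta_mx 0 i) s0.
  rewrite -(residualE H point) /lincomb (bigD1 i)//= mxE !eqxx scale1r yE big1 ?addr0.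
    by rewrite subrr [X in _ <= X]dot0l.
  by move=> j /negbTE ji; rewrite mxE ji andbF scale0r.
have := interpolant_error a (y i); rewrite r0 mulr0.
rewrite -normrX normr_le0 sqrf_eq0 subr_eq0 => /eqP ->.
by [].
Qed.

(** The interpolant [I] takes the values of the expansion at the nodes, so [|I|^2] is a pairing of
    [a] with the coordinates of [I]; Cauchy-Schwarz and Bessel give [|I|^4 <= |a|^2 |I|^2]. *)
Lemma interpolant_norm a :
  dot (interpolant a) (interpolant a) <= \sum_k `|a 0 k| ^+ 2.
Proof.
pose eta : 'rV[R[i]]_m := \row_i \sum_k a 0 k * \sum_j e k (y j) * (Ginv i j)^*.
have hE : interpolant a = \sum_i eta 0 i *: kern (y i).
  rewrite /interpolant; under eq_bigr do rewrite /interpolant_basis scaler_sumr.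
  rewrite exchange_big; apply: eq_bigr => i _; rewrite mxE scaler_suml.
  by apply: eq_bigr => k _; rewrite scalerA.
set q := dot _ _.
have qE : q = \sum_k a 0 k * (\sum_i eta 0 i * (e k (y i))^*)^*.
  rewrite /q [X in dot _ X]hE [LHS](linear_sumr dot).
  under [LHS]eq_bigr => i _.
    rewrite (linearZr_LR dot) /= -eval_dot interpolant_node /expansion mulr_sumr.
    over.
  rewrite exchange_big; apply: eq_bigr => k _.
  rewrite rmorph_sum mulr_sumr; apply: eq_bigr => i _.
  by rewrite rmorphM /= conjCK mulrCA.
have q0 : 0 <= q by exact: dot_ge0.
have := CauchySchwarz_sum (fun k => a 0 k) (fun k => (\sum_i eta 0 i * (e k (y i))^*)^*).
rewrite -qE ger0_norm// => qa.
have {}qa : q ^+ 2 <= (\sum_k `|a 0 k| ^+ 2) * q.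
  apply: le_trans qa _; rewrite ler_wpM2l ?sumr_ge0//.
  under eq_bigr do rewrite norm_conjC.
  by rewrite /q hE; exact: kern_bessel.
have [->|qn0] := eqVneq q 0; first by rewrite sumr_ge0// => k _; rewrite exprn_ge0.
by rewrite -(@ler_pM2r _ q) ?lt_def ?qn0.
Qed.
End Interpolation.

(** * Integrals of complex-valued functions *)

Section ComplexIntegral.
Variables (R : realType) (d : measure_display) (D : measurableType d).
Variable mu : {measure set D -> \bar R}.
Implicit Types (f g : D -> R[i]) (I J w : R[i]).

(** Integrability is bundled with the value so that linearity carries through finite sums. *)
Definition has_complex_integral f I := [/\
  mu.-integrable [set: D] (EFin \o (fun x => complex.Re (f x))),
  mu.-integrable [set: D] (EFin \o (fun x => complex.Im (f x))) &
  complex_integral mu f = I].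

Lemma has_complex_integralD f g I J :
  has_complex_integral f I -> has_complex_integral g J ->
  has_complex_integral (fun x => f x + g x) (I + J).
Proof.
move=> [fr fi <-] [gr gi <-].
have ReD x : complex.Re (f x + g x) = complex.Re (f x) + complex.Re (g x).
  by case: (f x) (g x) => ? ? [].
have ImD x : complex.Im (f x + g x) = complex.Im (f x) + complex.Im (g x).
  by case: (f x) (g x) => ? ? [].
split.
- have := integrableD measurableT fr gr; apply: eq_integrable => // x _ /=.
  by rewrite ReD EFinD.
- have := integrableD measurableT fi gi; apply: eq_integrable => // x _ /=.
  by rewrite ImD EFinD.
rewrite /complex_integral; under eq_Rintegral do rewrite ReD.
under [X in _ +i* X]eq_Rintegral do rewrite ImD.
by rewrite !RintegralD.
Qed.

Lemma has_complex_integralZ w f I : has_complex_integral f I ->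
  has_complex_integral (fun x => w * f x) (w * I).
Proof.
case: w => u v [fr fi <-].
have ReM x : complex.Re ((u +i* v) * f x) = u * complex.Re (f x) - v * complex.Im (f x).
  by case: (f x).
have ImM x : complex.Im ((u +i* v) * f x) = u * complex.Im (f x) + v * complex.Re (f x).
  by case: (f x).
have Zr c : mu.-integrable [set: D] (EFin \o (fun x => c * complex.Re (f x))).
  have := integrableZl measurableT c fr; exact: eq_integrable.
have Zi c : mu.-integrable [set: D] (EFin \o (fun x => c * complex.Im (f x))).
  have := integrableZl measurableT c fi; exact: eq_integrable.
split.
- have := integrableB measurableT (Zr u) (Zi v); apply: eq_integrable => // x _ /=.
  by rewrite ReM EFinB.
- have := integrableD measurableT (Zi u) (Zr v); apply: eq_integrable => // x _ /=.
  by rewrite ImM EFinD.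
rewrite /complex_integral; under eq_Rintegral do rewrite ReM.
under [X in _ +i* X]eq_Rintegral do rewrite ImM.
by rewrite RintegralB// RintegralD// !RintegralZl.
Qed.

Lemma has_complex_integral_sum (T : Type) (r : seq T) (f : T -> D -> R[i]) (I : T -> R[i]) :
  (forall i, has_complex_integral (f i) (I i)) ->
  has_complex_integral (fun x => \sum_(i <- r) f i x) (\sum_(i <- r) I i).
Proof.
move=> fI; elim: r => [|i r IH].
  rewrite big_nil; under eq_fun do rewrite big_nil.
  split; rewrite /= ?/comp; try exact: integrable0.
  by rewrite /complex_integral /= !Rintegral_cst// !mul0r.
rewrite big_cons; under eq_fun do rewrite big_cons.
exact: has_complex_integralD.
Qed.

Lemma L2_has_complex_integral f g : L2 mu f -> L2 mu g ->
  has_complex_integral (fun x => f x * (g x)^*) (complex_integral mu (fun x => f x * (g x)^*)).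
Proof.
have normcE (z : R[i]) : normc z ^+ 2 = complex.Re z ^+ 2 + complex.Im z ^+ 2.
  by case: z => u v /=; rewrite sqr_sqrtr// addr_ge0 ?sqr_ge0.
have sqrI h : L2 mu h -> mu.-integrable [set: D] (EFin \o (fun x => normc (h x) ^+ 2)).
  move=> [mr mi hoo]; apply/integrableP; split.
    apply/measurable_EFinP; under eq_fun do rewrite normcE.
    by apply: measurable_funD; exact: measurable_funX.
  apply: le_lt_trans hoo; rewrite le_eqVlt; apply/orP; left; apply/eqP.
  by apply: eq_integral => x _ /=; rewrite ger0_norm// sqr_ge0.
move=> fL gL; have fgI := integrableD measurableT (sqrI _ fL) (sqrI _ gL).
have [fr fi _] := fL; have [gr gi _] := gL.
have ReM x : complex.Re (f x * (g x)^*) = complex.Re (f x) * complex.Re (g x) +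
   complex.Im (f x) * complex.Im (g x).
  by case: (f x) (g x) => ? ? [? ?] /=; ring.
have ImM x : complex.Im (f x * (g x)^*) = complex.Im (f x) * complex.Re (g x) -
   complex.Re (f x) * complex.Im (g x).
  by case: (f x) (g x) => ? ? [? ?] /=; ring.
(* Both parts of the product are dominated by [|f|^2 + |g|^2]. *)
have dom (h : D -> R) : measurable_fun [set: D] h ->
    (forall x, - (normc (f x) ^+ 2 + normc (g x) ^+ 2) <= h x <=
       normc (f x) ^+ 2 + normc (g x) ^+ 2) ->
    mu.-integrable [set: D] (EFin \o h).
  move=> mh hfg; apply: (le_integrable measurableT _ _ fgI).
    exact/measurable_EFinP.
  by move=> x _ /=; rewrite lee_fin; apply: le_trans (ler_norm _); rewrite ler_norml hfg.
split=> //.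
- apply: dom.
    under eq_fun do rewrite ReM.
    by apply: measurable_funD; exact: measurable_funM.
  move=> x; rewrite ReM !normcE; apply/andP; split.
  + have := sqr_ge0 (complex.Re (f x) + complex.Re (g x)).
    by have := sqr_ge0 (complex.Im (f x) + complex.Im (g x)); nra.
  + have := sqr_ge0 (complex.Re (f x) - complex.Re (g x)).
    by have := sqr_ge0 (complex.Im (f x) - complex.Im (g x)); nra.
- apply: dom.
    under eq_fun do rewrite ImM.
    by apply: measurable_funB; exact: measurable_funM.
  move=> x; rewrite ImM !normcE; apply/andP; split.
  + have := sqr_ge0 (complex.Im (f x) + complex.Re (g x)).
    by have := sqr_ge0 (complex.Re (f x) - complex.Im (g x)); nra.
  + have := sqr_ge0 (complex.Im (f x) - complex.Re (g x)).
    by have := sqr_ge0 (complex.Re (f x) + complex.Im (g x)); nra.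
Qed.
End ComplexIntegral.

(** * Orthonormal families of coefficient vectors and weighted sums *)

Lemma orthonormal_left_kernel (C : numClosedFieldType) N n (T : 'M[C]_(N, n)) :
  exists r (Q : 'M[C]_(r, N)), [/\ (N - n <= r)%N, Q \is unitarymx & Q *m T = 0].
Proof.
have rN : (\rank (kermx T) <= N)%N by exact: rank_leq_row.
exists (\rank (kermx T)), (schmidt (row_base (kermx T))); split.
- by rewrite mxrank_ker leq_sub2l ?rank_leq_col.
- exact: schmidt_unitarymx.
apply/sub_kermxP; rewrite (eqmx_schmidt_free (row_base_free _)).
by rewrite eq_row_base.
Qed.

(** Let [a] combine the rows of [Q] with the conjugated entries of [Q *m v]. It is annihilated by
    [T], and both [a *m v] and [|a|^2] equal the sum [S] in question, so [S^2 <= delta S]. *)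
Lemma unitary_apply_le (C : numClosedFieldType) N r n (Q : 'M[C]_(r, N))
    (T : 'M[C]_(N, n)) (v : 'cV[C]_N) (delta : C) :
  Q \is unitarymx -> Q *m T = 0 -> 0 <= delta ->
  (forall a : 'rV_N, a *m T = 0 ->
     `|(a *m v) 0 0| ^+ 2 <= delta * \sum_k `|a 0 k| ^+ 2) ->
  \sum_j `|(Q *m v) j 0| ^+ 2 <= delta.
Proof.
move=> /unitarymxP QQ QT delta0 aT; set S := \sum_j _.
have S0 : 0 <= S by apply: sumr_ge0.
pose beta := Q *m v; pose a := (beta ^t*)%sesqui *m Q.
have /aT : a *m T = 0 by rewrite -mulmxA QT mulmx0.
have -> : (a *m v) 0 0 = S.
  rewrite -mulmxA -/beta mxE; apply: eq_bigr => j _.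
  by rewrite !mxE normCK mulrC.
have -> : \sum_k `|a 0 k| ^+ 2 = (a *m a ^t*)%sesqui 0 0.
  by rewrite [RHS]mxE; apply: eq_bigr => k _; rewrite [X in _ * X]mxE [a^T _ _]mxE normCK.
rewrite /a (trmx_mul (beta ^t*)%sesqui Q) map_mxM /= trmxCK -mulmxA (mulmxA Q) QQ mul1mx.
have -> : ((beta ^t*)%sesqui *m beta) 0 0 = S.
  by rewrite mxE; apply: eq_bigr => j _; rewrite !mxE normCK mulrC.
rewrite ger0_norm//; have [->//|Sn0] := eqVneq S 0.
by rewrite ler_pM2r// lt_def Sn0.
Qed.

(** Bessel's inequality for a unit vector; a matrix [T] without columns makes the constraint
    void. *)
Lemma unitary_column_le1 (C : numClosedFieldType) N r (Q : 'M[C]_(r, N)) k :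
  Q \is unitarymx -> \sum_j `|Q j k| ^+ 2 <= 1.
Proof.
move=> Qu.
have := @unitary_apply_le C N r 0 Q (0 : 'M[C]_(N, 0)) (delta_mx k 0) 1 Qu.
under eq_bigr do rewrite -colE mxE.
apply; rewrite ?mulmx0 ?ler01// => a _.
rewrite -colE mxE mul1r (bigD1 k)//= lerDl.
by apply: sumr_ge0.
Qed.

Lemma sum_norm_unitary (C : numClosedFieldType) N r (Q : 'M[C]_(r, N)) :
  Q \is unitarymx -> \sum_k \sum_j `|Q j k| ^+ 2 = r%:R.
Proof.
move=> /unitarymxP QQ; rewrite exchange_big /=.
rewrite (eq_bigr (fun=> 1)); first by rewrite sumr_const card_ord.
move=> j _; move/matrixP/(_ j j): QQ; rewrite !mxE eqxx mulr1n => <-.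
by apply: eq_bigr => k _; rewrite !mxE normCK.
Qed.

(* Weights in [[0, 1]] of total mass at least [N - n] cannot do better than
   concentrating on the [N - n] smallest terms. *)
Lemma tail_le_weighted_sum (R : realFieldType) (a p : nat -> R) n N :
  (forall k, 0 <= a k) -> (forall j k, (j <= k)%N -> a k <= a j) ->
  (forall k, (k < N)%N -> 0 <= p k <= 1) -> (N - n)%:R <= \sum_(k < N) p k ->
  \sum_(n <= k < N) a k <= \sum_(k < N) a k * p k.
Proof.
move=> a0 a_anti p01 Np.
have [Nn|nN] := leqP N n.
  rewrite big_geq//; apply: sumr_ge0 => k _; rewrite mulr_ge0//.
  by have /andP[] := p01 k (ltn_ord k).
rewrite -(big_mkord predT (fun k => a k * p k)).
(* Comparison with the threshold [a n]: for [k >= n] the two terms differ by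
   [(a n - a k) (1 - p k) >= 0]. *)
apply: le_trans (_ : \sum_(0 <= k < N) (a n * p k + (if (n <= k)%N then a k - a n else 0)) <= _).
  rewrite big_split /= -mulr_sumr.
  have -> : \sum_(0 <= k < N) (if (n <= k)%N then a k - a n else 0) =
      \sum_(n <= k < N) a k - a n * (N - n)%:R.
    rewrite (big_cat_nat (leq0n n) (ltnW nN))/= big_nat big1 ?add0r; last first.
      by move=> k /andP[_ kn]; rewrite leqNgt kn.
    transitivity (\sum_(n <= k < N) (a k - a n)); last first.
      by rewrite sumrB sumr_const_nat mulr_natr.
    by apply: eq_big_nat => k /andP[-> _].
  by rewrite [X in a n * X]big_mkord; have := ler_wpM2l (a0 n) Np; lra.
apply: ler_sum_nat => k /andP[_ kN]; have /andP[p0 p1] := p01 k kN.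
have [nk|kn] := leqP n k.
  rewrite -subr_ge0 (_ : _ - _ = (a n - a k) * (1 - p k)); last by ring.
  by rewrite mulr_ge0 ?subr_ge0 ?a_anti.
by rewrite addr0 ler_wpM2r// a_anti// ltnW.
Qed.

Lemma le_sqr_limit (R : realFieldType) (x m w : R) : 0 <= m -> 0 <= w ->
  (forall eps, 0 < eps -> x <= m * (w + eps) ^+ 2) -> x <= m * w ^+ 2.
Proof.
move=> m0 w0 xm; rewrite leNgt; apply/negP => wx.
pose M := m * (2 * w + 1); have M0 : 0 <= M by rewrite mulr_ge0// addr_ge0// mulr_ge0.
(* For [eps <= 1] the increment [m (w + eps)^2 - m w^2] is at most [M eps]; the [+ 1] keeps the
   denominator positive and the final inequality strict. *)
pose del := (x - m * w ^+ 2) / (M + 1).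
have del0 : 0 < del by rewrite divr_gt0 ?subr_gt0// ltr_wpDl.
have delE : del * (M + 1) = x - m * w ^+ 2 by rewrite divfK// gt_eqF// ltr_wpDl.
pose eps := Num.min 1 del.
have eps0 : 0 < eps by rewrite lt_min ltr01 del0.
have eps1 : eps <= 1 by rewrite ge_min lexx.
have epsdel : eps <= del by rewrite ge_min lexx orbT.
have := xm _ eps0; apply/negP; rewrite -ltNge.
have e2 : eps ^+ 2 <= eps by rewrite expr2 ger_pMl.
have : m * eps ^+ 2 <= m * eps by rewrite ler_wpM2l.
have : M * eps <= M * del by rewrite ler_wpM2l.
rewrite /M; move: delE; rewrite /M; nra.
Qed.

(** * Lower bound for Gelfand widths over a finite measure *)

Section GelfandWidth.
Variables (R : realType) (d : measure_display) (D : measurableType d).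
Variable mu : {measure set D -> \bar R}.
Variables (K : D -> D -> R[i]) (H : rkhs K).
Variables (sigma : nat -> R) (b : nat -> D -> R[i]) (B : R).
Hypotheses (sigma0 : forall k, 0 <= sigma k)
  (sigma_anti : forall j k, (j <= k)%N -> sigma k <= sigma j)
  (sigma_sum : (\sum_(0 <= k <oo) (sigma k ^+ 2)%:E < +oo)%E).
Hypothesis b_orthonormal : orthonormal_system mu b.
Hypothesis Kcvg : forall x y,
  (fun n => \sum_(0 <= k < n) (sigma k ^+ 2)%:C * b k x * (b k y)^* : R[i]^o)
    @ \oo --> (K x y : R[i]^o).
Hypotheses (B0 : 0 < B) (bB : forall n, (0 < n)%N ->
  (supnorm (fun x : D => (n%:R^-1 * \sum_(k < n) normc (b k x) ^+ 2)%:C)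
     <= B%:E)%E).
Hypothesis mu_fin : (mu [set: D] < +oo)%E.

Local Notation a := (fun k => sigma k ^+ 2).
Local Notation tail := (tail a).
Local Notation e := (scaled_basis sigma b).
Local Notation dot := (rkhs_dot H).
Local Notation kern := (@kern R D K H).
Local Notation residual := (@residual R D K H point).
Local Notation m := (fine (mu [set: D])).

(** After normalization, [g] and [- g] both carry information 0 and get the same output [psi 0], so
    the triangle inequality bounds [2 |g(x)|] by [2 c]. *)
Lemma annihilated_eval_le n (psi : 'rV[R[i]]_n -> D -> R[i])
    (N : {linear H -> 'rV[R[i]]_n}) (c : R) (f : H) (x : D) :
  (forall g : H, unit_ball g ->
     (supnorm (fun y => rkhs_eval g y - psi (N g) y)%R <= c%:E)%E) ->
  N f = 0 -> `|rkhs_eval f x| ^+ 2 <= (c ^+ 2)%:C * dot f f.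
Proof.
move=> Nc Nf; have [->|f0] := eqVneq f 0.
  by rewrite eval_dot [X in `|X|]dot0l normr0 expr0n [dot 0 0]dot0l mulr0.
have nf0 : 0 < `|f| by rewrite normr_gt0.
pose g := `|f|^-1 *: f.
have ng : `|g| = 1 by rewrite normrZ ger0_norm ?invr_ge0// mulVf// gt_eqF.
have Ng : N g = 0 by rewrite linearZ /= Nf scaler0.
have Ngx h : `|h| = 1 -> N h = 0 -> `|rkhs_eval h x - psi 0 x| <= c%:C.
  move=> nh Nh; have := Nc h; rewrite /unit_ball /= nh lexx Nh => /(_ isT).
  by move=> /(le_trans (le_supnorm _ x)); rewrite lee_fin -lecR.
have gc : `|rkhs_eval g x| <= c%:C.
  have gN : rkhs_eval (- g) x = - rkhs_eval g x.
    by rewrite !eval_dot [LHS](linearNl dot).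
  have := Ngx (- g); rewrite normrN linearN Ng oppr0 gN => /(_ ng erefl) h1.
  have h2 := Ngx g ng Ng.
  have : `|rkhs_eval g x *+ 2| <= c%:C *+ 2.
    have -> : rkhs_eval g x *+ 2 = (rkhs_eval g x - psi 0 x) - (- rkhs_eval g x - psi 0 x).
      by rewrite opprB opprK; ring.
    by apply: le_trans (ler_normB _ _) _; rewrite mulr2n lerD.
  by rewrite normrMn lerMn2r.
have fg : rkhs_eval f x = `|f| * rkhs_eval g x.
  rewrite !eval_dot [X in _ * X](linearZl_LR dot) /= mulrA divff ?mul1r//.
  by rewrite gt_eqF.
rewrite fg normrM normr_id exprMn rkhs_normE mulrC ler_wpM2r ?dot_ge0//.
by rewrite rmorphXn lerXn2r ?nnegrE//; apply: le_trans gc.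
Qed.

(** The pointwise bound is integrated over [D]; orthonormality of [b] removes the off-diagonal terms
    of the expanded squares. *)
Lemma orthonormal_weighted_sum_le N r (Q : 'M[R[i]]_(r, N)) (delta : R) :
  (forall x, \sum_j `|(Q *m \col_k e k x) j 0| ^+ 2 <= delta%:C) ->
  complex.Re (\sum_(k < N) (a k)%:C * \sum_j `|Q j k| ^+ 2) <= m * delta.
Proof.
move=> Qd; have [bL b1] := b_orthonormal.
pose w j (k l : 'I_N) : R[i] := Q j k * (Q j l)^* * (sigma k * sigma l)%:C.
pose F x := \sum_j \sum_k \sum_l w j k l * (b k x * (b l x)^*).
have FE x : F x = \sum_j `|(Q *m \col_k e k x) j 0| ^+ 2.
  apply: eq_bigr => j _; rewrite normCK mxE rmorph_sum mulr_suml.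
  apply: eq_bigr => k _; rewrite mulr_sumr; apply: eq_bigr => l _.
  rewrite !mxE /scaled_basis !rmorphM /= (@conj_Creal _ (sigma l)%:C) ?complex_real//.
  by rewrite /w rmorphM /=; ring.
have FI : has_complex_integral mu F (\sum_(k < N) (a k)%:C * \sum_j `|Q j k| ^+ 2).
  have -> : \sum_(k < N) (a k)%:C * (\sum_j `|Q j k| ^+ 2) =
      \sum_j \sum_k \sum_l w j k l * (k == l :> nat)%:R.
    under eq_bigr do rewrite mulr_sumr.
    rewrite exchange_big; apply: eq_bigr => j _; apply: eq_bigr => k _.
    rewrite (bigD1 k)//= eqxx mulr1 big1 ?addr0; last first.
      move=> l lk; rewrite (_ : (k == l :> nat) = false) ?mulr0//.
      by apply/negbTE; rewrite eq_sym.
    by rewrite /w normCK -expr2 mulrC.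
  apply: has_complex_integral_sum => j; apply: has_complex_integral_sum => k.
  apply: has_complex_integral_sum => l; apply: has_complex_integralZ.
  by rewrite -(b1 k l); exact: L2_has_complex_integral.
have [Fr _ <-] := FI; rewrite /complex_integral /=.
have mf : mu [set: D] \is a fin_num by rewrite ge0_fin_numE.
rewrite mulrC -Rintegral_cst//; apply: le_Rintegral => //.
  apply/integrableP; split; first exact: measurable_cst.
  by rewrite integral_cst//= lte_mul_pinfty// lee_fin.
by move=> x _; have := Qd x; rewrite -FE lecE => /andP[].
Qed.

Lemma tail_le_measure n (psi : 'rV[R[i]]_n -> D -> R[i])
    (N : {linear H -> 'rV[R[i]]_n}) (c eps : R) : 0 <= c -> 0 < eps ->
  (forall g : H, unit_ball g ->
     (supnorm (fun y => rkhs_eval g y - psi (N g) y)%R <= c%:E)%E) ->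
  tail n <= m * (c + eps) ^+ 2.
Proof.
move=> c0 eps0 Nc.
have a0 k : 0 <= a k by exact: sqr_ge0.
have a_anti j k : (j <= k)%N -> a k <= a j.
  by move=> jk; rewrite lerXn2r ?nnegrE ?sigma_anti.
rewrite -lee_fin -tailE//; apply: series_le => // M; rewrite lee_fin.
(* Chosen so that [64 B tail n' < eps^2], which makes every residual norm at most [eps]. *)
have eB : 0 < eps ^+ 2 / (64 * B) by rewrite divr_gt0 ?exprn_gt0 ?mulr_gt0.
have [n' n'0 tn'] := tail_small a0 sigma_sum eB.
have [s [_ s0 sP]] := bounded_sampling_points H sigma0 sigma_anti sigma_sum Kcvg B0 bB n'0.
have res x : dot (residual s x) (residual s x) <= (eps ^+ 2)%:C.
  apply: le_trans (sP x) _; rewrite lecR mulrC -ler_pdivlMr ?mulr_gt0//.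
  exact: ltW.
have s0' : gdet dot (map kern s) != 0 by rewrite gt_eqF.
pose ecvg := scaled_basis_cvg Kcvg.
(* Row [k] is the information on the interpolant of [e k], so [v *m T = 0] means that [N]
   annihilates the interpolant of the expansion with coefficients [v]. *)
pose T : 'M[R[i]]_(M, n) := \matrix_(k, i) N (interpolant_basis H e s k) 0 i.
have [r [Q [Mr Qu QT]]] := orthonormal_left_kernel T.
have exp_le (v : 'rV_M) x : v *m T = 0 ->
    `|expansion e v x| ^+ 2 <= ((c + eps) ^+ 2)%:C * \sum_k `|v 0 k| ^+ 2.
  move=> vT; set A := \sum_k _; have A0 : 0 <= A by apply: sumr_ge0.
  pose I := interpolant H e s v.
  have NI : N I = 0.
    rewrite linear_sum -[RHS]vT; apply/rowP => i.
    rewrite summxE mxE; apply: eq_bigr => k _.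
    by rewrite linearZ !mxE.
  have I_le : `|rkhs_eval I x| <= c%:C * sqrtC A.
    rewrite -(@ler_pXn2r _ 2)// ?nnegrE ?mulr_ge0 ?sqrtC_ge0 ?ler0c//.
    apply: le_trans (annihilated_eval_le x Nc NI) _.
    rewrite exprMn sqrtCK rmorphXn ler_wpM2l ?exprn_ge0 ?ler0c//.
    exact: interpolant_norm.
  have err_le : `|expansion e v x - rkhs_eval I x| <= eps%:C * sqrtC A.
    rewrite -(@ler_pXn2r _ 2)// ?nnegrE ?mulr_ge0 ?sqrtC_ge0 ?ler0c ?(ltW eps0)//.
    apply: le_trans (interpolant_error H ecvg s v x) _.
    by rewrite exprMn sqrtCK mulrC -rmorphXn ler_wpM2r.
  have -> : ((c + eps) ^+ 2)%:C * A = ((c + eps)%:C * sqrtC A) ^+ 2.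
    by rewrite exprMn sqrtCK rmorphXn.
  have ce0 : 0 <= c + eps by rewrite addr_ge0// ltW.
  rewrite lerXn2r ?nnegrE ?normr_ge0 ?mulr_ge0 ?sqrtC_ge0 ?ler0c//.
  rewrite -[expansion e v x](subrK (rkhs_eval I x)) addrC.
  apply: le_trans (ler_normD _ _) _.
  by rewrite rmorphD mulrDl lerD.
have Qe x : \sum_j `|(Q *m \col_k e k x) j 0| ^+ 2 <= ((c + eps) ^+ 2)%:C.
  apply: (unitary_apply_le Qu QT); first by rewrite ler0c sqr_ge0.
  move=> v /(exp_le v x); congr (`|_| ^+ 2 <= _).
  by rewrite mxE; apply: eq_bigr => k _; rewrite mxE.
apply: le_trans (orthonormal_weighted_sum_le Qe).
(* The weights are the squared column norms of [Q]: each at most 1, of total [r >= M - n]. *)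
pose p k := if insub k is Some i then complex.Re (\sum_j `|Q j (i : 'I_M)| ^+ 2) else 0.
have pE (k : 'I_M) : \sum_j `|Q j k| ^+ 2 = (p k)%:C.
  rewrite /p valK RRe_real// ger0_real//; exact: sumr_ge0.
have -> : complex.Re (\sum_(k < M) (a k)%:C * \sum_j `|Q j k| ^+ 2) = \sum_(k < M) a k * p k.
  under eq_bigr do rewrite pE -rmorphM.
  by rewrite -rmorph_sum.
apply: tail_le_weighted_sum => //.
  move=> k kM; rewrite -lecR -[p k <= 1]lecR -(pE (Ordinal kM)) unitary_column_le1// andbT.
  exact: sumr_ge0.
rewrite -lecR rmorph_sum /=; under eq_bigr do rewrite -pE.
by rewrite (sum_norm_unitary Qu) rmorph_nat ler_nat.
Qed.

Local Notation g n := (rkhs_lin_sampling_number n H (@Linfty R D) (@supnorm R D)).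
Local Notation w n := (rkhs_gelfand_width n H (@Linfty R D) (@supnorm R D)).

Lemma sampling_number_gelfand n : (0 < n)%N ->
  (g (4 * n) <= (Num.sqrt (B * 64%:R * m))%:E * w n)%E.
Proof.
move=> n0; have m0 : 0 <= m by rewrite fine_ge0.
have w0 : (0 <= w n)%E.
  apply: le_ereal_inf_tmp => _ [psiN _ <-].
  apply: (@le_trans _ _ (supnorm (fun y => rkhs_eval (0 : H) y - psiN.1 (psiN.2 0) y)%R)).
    apply: le_trans (le_supnorm _ point); rewrite lee_fin.
    by case: (_ - _) => ? ?; exact: sqrtr_ge0.
  apply: ereal_sup_ubound; exists 0 => //.
  by rewrite /unit_ball /= normr0.
(* The zero method has error at most the square root of [kappa]; finiteness lets the width be
   treated as a real number [W]. *)
have woo : (w n < +oo)%E.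
  pose kappa := 2 * B * tail 0.
  have kk x : dot (kern x) (kern x) <= kappa%:C by exact: dot_kern_le.
  have k0 := kappa_ge0 kk.
  apply: (@le_lt_trans _ _ (Num.sqrt kappa)%:E); last exact: ltry.
  apply: ge_ereal_inf; exists (ereal_sup [set supnorm (fun y => rkhs_eval f y -
     (fun _ _ => 0) ((\0 : {linear H -> 'rV_n}) f) y) | f in @unit_ball R H]).
    exists (fun _ _ => 0, (\0 : {linear H -> 'rV_n})) => // v.
    by apply: (@Linfty_bounded _ _ _ 0) => x; rewrite normr0.
  apply: ge_ereal_sup => _ [f /unit_ballE f1 <-]; apply: supnorm_le => x.
  rewrite subr0; apply: le_trans (eval_bounded kk f x) _.
  rewrite -(@ler_pXn2r _ 2)// ?nnegrE ?sqrtC_ge0 ?mulr_ge0 ?dot_ge0 ?ler0c ?sqrtr_ge0//.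
  by rewrite sqrtCK -rmorphXn sqr_sqrtr// ler_piMl ?ler0c.
have wf : w n = (fine (w n))%:E by rewrite fineK// ge0_fin_numE.
set W := fine (w n) in wf; have W0 : 0 <= W by rewrite fine_ge0.
have tW : tail n <= m * W ^+ 2.
  apply: le_sqr_limit => // eps eps0.
  (* Half of [eps] goes to a near-optimal pair of [psi] and [N], the other half to the interpolation
     error. *)
  have e20 : 0 < eps / 2 by rewrite divr_gt0.
  have wfin : w n \is a fin_num by rewrite wf.
  have [_ [[psi N] _ <-]] := lb_ereal_inf_adherent e20 wfin.
  rewrite -[ereal_inf _]/(w n) wf -EFinD => cW.
  have -> : W + eps = (W + eps / 2) + eps / 2 by lra.
  apply: (tail_le_measure (psi := psi) (N := N)) => //; first by rewrite addr_ge0// ltW.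
  move=> f f1; apply: le_trans (ltW cW).
  by apply: ereal_sup_ubound; exists f.
apply: le_trans (sampling_number_tail H sigma0 sigma_anti sigma_sum Kcvg B0 bB n0) _.
rewrite wf -EFinM lee_fin -[W](ger0_norm W0) -sqrtr_sqr -sqrtrM; last first.
  by rewrite !mulr_ge0// ltW.
by rewrite ler_wsqrtr// -[leRHS]mulrA ler_wpM2l// mulr_ge0// ltW.
Qed.
End GelfandWidth.

(* Sequences are indexed from 0: sigma k and b k are sigma_{k+1} and b_{k+1}. *)
Theorem theorem11 :
  exists c C : nat, (0 < c)%N /\ (0 < C)%N /\
  forall (R : realType) (d : measure_display) (D : measurableType d)
    (mu : {measure set D -> \bar R})
    (K : D -> D -> R[i]) (H : rkhs K)
    (sigma : nat -> R) (b : nat -> D -> R[i]) (B : R),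
  rkhs_functions H `<=` L2 mu ->
  (forall k, 0 <= sigma k) ->
  (forall j k, (j <= k)%N -> sigma k <= sigma j) ->
  (\sum_(0 <= k <oo) (sigma k ^+ 2)%:E < +oo)%E ->
  orthonormal_system mu b ->
  (forall x y,
     (fun n => \sum_(0 <= k < n) (sigma k ^+ 2)%:C * b k x * (b k y)^* : R[i]^o)
       @ \oo --> (K x y : R[i]^o)) ->
  0 < B ->
  (forall n, (0 < n)%N ->
     (supnorm (fun x : D => (n%:R^-1 * \sum_(k < n) normc (b k x) ^+ 2)%:C)
       <= B%:E)%E) ->
  [/\ rkhs_functions H `<=` @Linfty R D,
      (forall n, (0 < n)%N ->
         (rkhs_lin_sampling_number (c * n) H (@Linfty R D) (@supnorm R D) ^+ 2
          <= (B * C%:R)%:E * \sum_(n <= k <oo) (sigma k ^+ 2)%:E)%E) &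
      ((mu [set: D] < +oo)%E -> forall n, (0 < n)%N ->
         (rkhs_lin_sampling_number (c * n) H (@Linfty R D) (@supnorm R D)
          <= (Num.sqrt (B * C%:R * fine (mu [set: D])))%:E *
             rkhs_gelfand_width n H (@Linfty R D) (@supnorm R D))%E)].
Proof.
(* [4 = 2 * 2]: fewer than [2 m] points at [m = 2 n]. [64 = 32 * 2]: near-maximal volumes give 32,
   summation by parts gives 2. *)
exists 4, 64; do 2 split=> //.
move=> R d D mu K H sigma b B _ sigma0 sigma_anti sigma_sum b_on Kcvg B0 bB; split.
- exact: (rkhs_functions_Linfty sigma0 sigma_anti sigma_sum Kcvg B0 bB).
- move=> n n0.
  exact: (sampling_number_tail_sqr H sigma0 sigma_anti sigma_sum Kcvg B0 bB n0).
move=> mu_fin n n0.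
exact: (sampling_number_gelfand H sigma0 sigma_anti sigma_sum b_on Kcvg B0 bB mu_fin n0).
Qed.
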